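(* Let $(X,T)$ be a null dynamical system. Then the following are equivalent: (1) $P(X,T)$ is closed in $X\times X$; (2) $P(X,T)=Q(X,T)$; (3) $(X,T)$ is mean equicontinuous.
   Context: A dynamical system $(X,T)$ is a compact metric space $(X,d)$ with a continuous map $T:X\to X$. $P(X,T)$ is the set of proximal pairs: $(x,y)$ with $\inf_{n\ge1}d(T^nx,T^ny)=0$. $Q(X,T)$ is the set of regionally proximal pairs: $(x,y)$ such that for every $\epsilon>0$ there are $x',y'\in X$ with $d(x,x')<\epsilon$, $d(y,y')<\epsilon$ and a positive integer $n$ with $d(T^nx',T^ny')<\epsilon$. $(X,T)$ is mean equicontinuous if for every $\epsilon>0$ there is $\delta>0$ such that $d(x,y)<\delta$ implies $\limsup_{n\to\infty}\frac1n\sum_{i=0}^{n-1}d(T^ix,T^iy)<\epsilon$. For an increasing sequence $A=\{0\le t_1<t_2<\cdots\}\subseteq\mathbb{Z}_+$ and a finite open cover $\mathcal U$, $h^A_{top}(T,\mathcal U)=\limsup_{n\to\infty}\frac1n\log N(\bigvee_{i=1}^nT^{-t_i}\mathcal U)$, where $N(\cdot)$ is the minimal cardinality of a subcover, and $h^A_{top}(T)=\sup_{\mathcal U}h^A_{top}(T,\mathcal U)$. $(X,T)$ is null if $h^A_{top}(T)=0$ for every increasing sequence $A$. *)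

(* Defs.v *)
From Stdlib Require Import Reals Lra List.
Open Scope R_scope.

Definition is_metric {X : Type} (d : X -> X -> R) : Prop :=
  (forall x y, 0 <= d x y) /\
  (forall x y, d x y = 0 <-> x = y) /\
  (forall x y, d x y = d y x) /\
  (forall x y z, d x z <= d x y + d y z).

Definition is_open {X : Type} (d : X -> X -> R) (U : X -> Prop) : Prop :=
  forall x, U x -> exists r, 0 < r /\ forall y, d x y < r -> U y.

Definition is_compact {X : Type} (d : X -> X -> R) : Prop :=
  forall (I : Type) (V : I -> X -> Prop),
    (forall i, is_open d (V i)) -> (forall x, exists i, V i x) ->
    exists l : list I, forall x, exists i, In i l /\ V i x.

Definition is_continuous {X : Type} (d : X -> X -> R) (T : X -> X) : Prop :=
  forall x eps, 0 < eps -> exists delta, 0 < delta /\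
    forall y, d x y < delta -> d (T x) (T y) < eps.

Definition dyn_system {X : Type} (d : X -> X -> R) (T : X -> X) : Prop :=
  is_metric d /\ is_compact d /\ is_continuous d T.

Definition is_limsup (a : nat -> R) (l : R) : Prop :=
  forall eps, 0 < eps ->
    (exists M, forall n, (M <= n)%nat -> a n < l + eps) /\
    (forall M, exists n, (M <= n)%nat /\ l - eps < a n).

(* inf_{n>=1} d(T^n x, T^n y) = 0 (distances are nonnegative) *)
Definition proximal {X : Type} (d : X -> X -> R) (T : X -> X) (x y : X) : Prop :=
  forall eps, 0 < eps -> exists n, (1 <= n)%nat /\
    d (Nat.iter n T x) (Nat.iter n T y) < eps.

Definition reg_proximal {X : Type} (d : X -> X -> R) (T : X -> X) (x y : X) : Prop :=
  forall eps, 0 < eps -> exists x' y' n,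
    d x x' < eps /\ d y y' < eps /\ (1 <= n)%nat /\
    d (Nat.iter n T x') (Nat.iter n T y') < eps.

Definition closed_rel {X : Type} (d : X -> X -> R) (P : X -> X -> Prop) : Prop :=
  forall x y, ~ P x y -> exists r, 0 < r /\
    forall x' y', d x x' < r -> d y y' < r -> ~ P x' y'.

(* average (1/(n+1)) sum_{i=0}^{n} d(T^i x, T^i y), i.e. the n+1-th Cesaro mean *)
Definition mean_dist {X : Type} (d : X -> X -> R) (T : X -> X) (x y : X) (n : nat) : R :=
  sum_f_R0 (fun i => d (Nat.iter i T x) (Nat.iter i T y)) n / INR (S n).

Definition mean_equicontinuous {X : Type} (d : X -> X -> R) (T : X -> X) : Prop :=
  forall eps, 0 < eps -> exists delta, 0 < delta /\
    forall x y, d x y < delta ->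
      exists l, is_limsup (mean_dist d T x y) l /\ l < eps.

Definition empty_set {X : Type} : X -> Prop := fun _ => False.

Definition finite_open_cover {X : Type} (d : X -> X -> R) (U : list (X -> Prop)) : Prop :=
  (forall V, In V U -> is_open d V) /\ (forall x, exists V, In V U /\ V x).

(* strictly increasing sequence A = {t_1 < t_2 < ...} in Z_+, t_{i+1} = A i *)
Definition strictly_increasing (A : nat -> nat) : Prop :=
  forall i, (A i < A (S i))%nat.

(* member of  \/_{i=1}^n T^{-t_i} U  selected by w : U_{w 0} /\ ... /\ U_{w (n-1)} *)
Definition join_member {X : Type} (T : X -> X) (U : list (X -> Prop))
    (A : nat -> nat) (n : nat) (w : nat -> nat) : X -> Prop :=
  fun x => forall i, (i < n)%nat -> nth (w i) U empty_set (Nat.iter (A i) T x).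

Definition valid_index {X : Type} (U : list (X -> Prop)) (n : nat) (w : nat -> nat) : Prop :=
  forall i, (i < n)%nat -> (w i < length U)%nat.

Definition join_subcover {X : Type} (T : X -> X) (U : list (X -> Prop))
    (A : nat -> nat) (n : nat) (ws : list (nat -> nat)) : Prop :=
  (forall w, In w ws -> valid_index U n w) /\
  (forall x, exists w, In w ws /\ join_member T U A n w x).

Definition is_join_N {X : Type} (T : X -> X) (U : list (X -> Prop))
    (A : nat -> nat) (n k : nat) : Prop :=
  (exists ws, join_subcover T U A n ws /\ length ws = k) /\
  (forall ws, join_subcover T U A n ws -> (k <= length ws)%nat).

(* h^A_top(T,U) = limsup_n (1/n) log N(\/_{i=1}^n T^{-t_i} U) = h ;
   sequence reindexed by n+1 >= 1 *)
Definition is_seq_entropy_cover {X : Type} (T : X -> X) (U : list (X -> Prop))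
    (A : nat -> nat) (h : R) : Prop :=
  forall N : nat -> nat, (forall n, is_join_N T U A n (N n)) ->
    is_limsup (fun n => ln (INR (N (S n))) / INR (S n)) h.

(* null: h^A_top(T) = sup_U h^A_top(T,U) = 0 for every increasing A;
   since each h^A_top(T,U) >= 0, this means h^A_top(T,U) = 0 for all U *)
Definition null_system {X : Type} (d : X -> X -> R) (T : X -> X) : Prop :=
  forall A, strictly_increasing A ->
  forall U, finite_open_cover d U -> is_seq_entropy_cover T U A 0.

(* Main.v *)
Require Import Defs.
From Stdlib Require Import Reals List.
From Stdlib Require Import Lra Lia Classical ClassicalEpsilon FinFun Sorted.
From Stdlib Require Import FunctionalExtensionality PropExtensionality.
From mathcomp Require classical_sets.
Import ListNotations.
Open Scope R_scope.

(* The upper mean distance is invariant, so in a mean equicontinuous system it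
   vanishes on regionally proximal pairs, which are then proximal; and the
   regionally proximal relation is always closed.

   The remaining implication (P closed gives mean equicontinuity) rests on one
   consequence of nullness: for e1 < e2 there is a bound on the number of pairs
   (x_j, y_j) such that every far (>= e2) or close (<= e1) pattern of the
   distances d(T^t x_j, T^t y_j) is realised at some time t. This bound is
   violated in two steps. All limits are taken along a minimal idempotent
   ultrafilter on nat.

   When P is closed, it is an equivalence relation, and for a proximal pair the
   times of closeness contain long intervals with bounded gaps.

   Step 1: if x_k, y_k -> z then every limit of T^(n_k) (x_k, y_k) is proximal.
   Otherwise, the images x'_k, y'_k of the points under the idempotent are
   jointly uniformly recurrent and proximal to x_k, y_k, so (x'_k, y'_k) has
   long windows of closeness and long windows of separation; choosing the pairs
   one by one with faster and faster growing windows realises all patterns.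

   Step 2: if mean equicontinuity fails, a limit as in Step 1 is a proximal pair
   whose times of separation F have positive density, while its times of
   closeness N are thickly syndetic. A Hilbert cube built from return times of F
   then shows that some integers t_1, ..., t_m have all patterns realised: for
   every s there is n with n + t_i in F if s_i = 1 and in N if s_i = 0. *)

(** * Idempotent ultrafilters *)

Definition shift (A : nat -> Prop) (n : nat) : nat -> Prop := fun k => A (n + k)%nat.

Record is_filter (F : (nat -> Prop) -> Prop) : Prop := {
  filter_true : F (fun _ => True);
  filter_and : forall A B, F A -> F B -> F (fun n => A n /\ B n);
  filter_mono : forall A B, F A -> (forall n, A n -> B n) -> F B;
  filter_proper : ~ F (fun _ => False) }.

(** Zorn's lemma: the union of a nonempty chain of filters is a filter, and [Hunion] carries [Phi]
    over to it. *)
Lemma maximal_filter (Phi : ((nat -> Prop) -> Prop) -> Prop)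
  (Hunion : forall C : ((nat -> Prop) -> Prop) -> Prop,
     (exists F, C F) -> (forall F, C F -> is_filter F /\ Phi F) ->
     Phi (fun A => exists F, C F /\ F A))
  (F0 : (nat -> Prop) -> Prop) (HF0 : is_filter F0) (HPhi0 : Phi F0) :
  exists F, is_filter F /\ Phi F /\ (forall A, F0 A -> F A) /\
    forall G, is_filter G -> Phi G -> (forall A, F A -> G A) -> forall A, G A -> F A.
Proof.
  set (good := fun F => is_filter F /\ Phi F).
  (* Adjoining [F0] makes the Zorn property hold for the empty chain too, whose union is empty. *)
  set (ext := fun (F : (nat -> Prop) -> Prop) A => F A \/ F0 A).
  destruct (@classical_sets.Zorn_bigcup (nat -> Prop) (fun F => good (ext F)))
    as [F [HF Hmax]].
  - intros C HC Htot.
    destruct (classic (exists F, C F)) as [Hne | Hempty].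
    + set (C' := fun G => exists F, C F /\ G = ext F).
      assert (Hgood : forall G, C' G -> is_filter G /\ Phi G)
        by (intros G [F [HF ->]]; exact (HC F HF)).
      assert (Htot' : forall G H, C' G -> C' H ->
        (forall A, G A -> H A) \/ (forall A, H A -> G A)).
      { intros G H [F1 [H1 ->]] [F2 [H2 ->]].
        destruct (Htot F1 F2 H1 H2) as [S | S]; [left | right];
          intros A [HA | HA]; [left; apply S, HA | right; exact HA
            | left; apply S, HA | right; exact HA]. }
      assert (Hne' : exists G, C' G)
        by (destruct Hne as [F HF]; exists (ext F), F; auto).
      assert (Heq : ext (classical_sets.bigcup C (fun X => X))
                    = (fun A => exists G, C' G /\ G A)).
      { apply functional_extensionality; intro A; apply propositional_extensionality.
        split.
        - intros [[F HF HA] | HA].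
          + exists (ext F); split; [exists F; auto | left; exact HA].
          + destruct Hne as [F HF]. exists (ext F); split; [exists F; auto | right; exact HA].
        - intros [G [[F [HF ->]] [HA | HA]]]; [left; exists F; auto | right; exact HA]. }
      rewrite Heq. split; [| apply Hunion; assumption].
      split.
      * destruct Hne' as [G HG]. exists G; split; [exact HG |].
        apply filter_true, Hgood, HG.
      * intros A B [G [HG HA]] [H [HH HB]].
        destruct (Htot' G H HG HH) as [S | S].
        -- exists H; split; [exact HH |]. apply filter_and; auto. apply Hgood, HH.
        -- exists G; split; [exact HG |]. apply filter_and; auto. apply Hgood, HG.
      * intros A B [G [HG HA]] HAB. exists G; split; [exact HG |].
        apply (filter_mono _ (proj1 (Hgood G HG)) A); auto.
      * intros [G [HG HA]]. exact (filter_proper _ (proj1 (Hgood G HG)) HA).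
    + assert (Heq : ext (classical_sets.bigcup C (fun X => X)) = F0).
      { apply functional_extensionality; intro A; apply propositional_extensionality.
        split; [intros [[F HF HA] | HA] | right; assumption]; [| exact HA].
        exfalso; apply Hempty; exists F; exact HF. }
      rewrite Heq. split; assumption.
  - exists (ext F). split; [apply HF | split; [apply HF | split]].
    + intros A HA; right; exact HA.
    + intros G HG HPG HFG A HA. left.
      apply NNPP; intro HnA.
      apply (Hmax G).
      * split; [intros B HB; apply HFG; left; exact HB |].
        intro HGF. apply HnA, HGF, HA.
      * assert (Heq : ext G = G).
        { apply functional_extensionality; intro B; apply propositional_extensionality.
          split; [intros [HB | HB]; [exact HB | apply HFG; right; exact HB] | left; assumption]. }
        rewrite Heq; split; assumption.
Qed.

Definition ultrafilter (p : (nat -> Prop) -> Prop) : Prop :=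
  is_filter p /\ forall A, p A \/ p (fun n => ~ A n).

Lemma extend_filter_by F (B : nat -> Prop) :
  is_filter F -> ~ F (fun n => ~ B n) ->
  is_filter (fun S => exists A, F A /\ forall n, A n -> B n -> S n).
Proof.
  intros HF HB. split.
  - exists (fun _ => True); split; [apply filter_true, HF | auto].
  - intros S1 S2 [A1 [H1 I1]] [A2 [H2 I2]].
    exists (fun n => A1 n /\ A2 n); split; [apply filter_and; auto |].
    intros n [] ?; split; auto.
  - intros S1 S2 [A1 [H1 I1]] H12. exists A1; split; auto.
  - intros [A [HA I]]. apply HB.
    apply (filter_mono _ HF A); [exact HA |]. intros n Hn Bn. exact (I n Hn Bn).
Qed.

Lemma ultrafilter_extension F0 :
  is_filter F0 -> exists p, ultrafilter p /\ forall A, F0 A -> p A.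
Proof.
  intro HF0.
  destruct (maximal_filter (fun _ => True)) with (F0 := F0) as [p [Hp [_ [Hsub Hmax]]]]; auto.
  exists p. split; [| exact Hsub]. split; [exact Hp |]. intro A.
  destruct (classic (p (fun n => ~ A n))) as [HA | HA]; [right; exact HA | left].
  apply (Hmax _ (extend_filter_by p A Hp HA)); auto.
  - intros B HB. exists B; auto.
  - exists (fun _ => True); split; [apply filter_true, Hp | auto].
Qed.

Definition cofinite_filter (F : (nat -> Prop) -> Prop) : Prop :=
  forall m, F (fun n => m <= n)%nat.

Definition shift_invariant (F : (nat -> Prop) -> Prop) : Prop :=
  forall A, F A -> F (shift A 1).

(* A maximal shift-invariant filter is the filter of a minimal closed left
   ideal of the semigroup of ultrafilters, and the positive sets of such a
   filter have finitely many translates covering a member of it. *)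
Lemma minimal_left_ideal :
  exists F, is_filter F /\ cofinite_filter F /\ shift_invariant F /\
    forall A, ~ F (fun n => ~ A n) ->
      exists L, F (fun n => exists j, (j <= L)%nat /\ A (n + j)%nat).
Proof.
  destruct (maximal_filter shift_invariant)
    with (F0 := fun A => exists m, forall n, (m <= n)%nat -> A n)
    as [F [HF [Hinv [Hcof Hmax]]]].
  - intros C _ HC A [F [HF HA]]. exists F; split; [exact HF |]. apply HC; assumption.
  - split.
    + exists 0%nat; auto.
    + intros A B [m Hm] [k Hk]. exists (m + k)%nat.
      intros n Hn; split; [apply Hm | apply Hk]; lia.
    + intros A B [m Hm] HAB. exists m; auto.
    + intros [m Hm]. exact (Hm m (le_n m)).
  - intros A [m Hm]. exists m. intros n Hn. apply Hm; lia.
  - exists F. split; [exact HF | split; [| split; [exact Hinv |]]].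
    + intro m. apply Hcof. exists m; auto.
    + intros A HA. apply NNPP; intro Hno. apply HA.
      (* The sets [B L] generate together with [F] a filter, proper by [HB] and shift-invariant
         since [B (S L)] lies in the shift of [B L] by 1. Maximality puts it inside [F], and [B 0]
         is the complement of [A]. *)
      set (B := fun L n => forall j, (j <= L)%nat -> ~ A (n + j)%nat).
      assert (HB : forall L, ~ F (fun n => ~ B L n)).
      { intros L HL. apply Hno. exists L.
        apply (filter_mono _ HF _ _ HL). intros n Hn.
        apply NNPP; intro H. apply Hn. intros j Hj HAj. apply H. exists j; auto. }
      apply (Hmax (fun S => exists L, exists D, F D /\ forall n, D n -> B L n -> S n)).
      * split.
        -- exists 0%nat, (fun _ => True); split; [apply filter_true, HF | auto].
        -- intros S1 S2 [L1 [A1 [H1 I1]]] [L2 [A2 [H2 I2]]].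
           exists (L1 + L2)%nat, (fun n => A1 n /\ A2 n).
           split; [apply filter_and; auto |].
           intros n [X1 X2] X; split; [apply I1 | apply I2]; auto;
             intros j Hj; apply X; lia.
        -- intros S1 S2 [L1 [A1 [H1 I1]]] H12. exists L1, A1; split; auto.
        -- intros [L [D [HD I]]]. apply (HB L).
           apply (filter_mono _ HF D); [exact HD |].
           intros n Hn Bn; exact (I n Hn Bn).
      * intros E [L [D [HD I]]]. exists (S L), (shift D 1).
        split; [apply Hinv, HD |].
        intros n Dn Bn. apply I; [exact Dn |]. intros j Hj.
        replace (1 + n + j)%nat with (n + (1 + j))%nat by lia. apply Bn; lia.
      * intros D HD. exists 0%nat, D; auto.
      * exists 0%nat, (fun _ => True). split; [apply filter_true, HF |].
        intros n _ Bn. specialize (Bn 0%nat (le_n 0)).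
        replace (n + 0)%nat with n in Bn by lia. exact Bn.
Qed.

(* For ultrafilters, [filter_prod p q] is the product of the semigroup: the limit of
   T^n along it is the composition of the limits along [p] and [q]. *)
Definition filter_prod (F G : (nat -> Prop) -> Prop) : (nat -> Prop) -> Prop :=
  fun A => F (fun n => G (shift A n)).

Lemma shift_shift A m n : shift (shift A m) n = shift A (m + n).
Proof.
  unfold shift. apply functional_extensionality; intro k. f_equal; lia.
Qed.

Lemma shift_invariant_iter F A n : shift_invariant F -> F A -> F (shift A n).
Proof.
  intros HF HA. induction n as [| n IH].
  - replace (shift A 0) with A; [exact HA |]. reflexivity.
  - replace (S n) with (n + 1)%nat by lia. rewrite <- shift_shift. apply HF, IH.
Qed.

(* Ellis's lemma, with closed subsemigroups of ultrafilters replaced by the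
   filters [F] contained in [filter_prod F F]. *)
Lemma idempotent_ultrafilter_extension F0 :
  is_filter F0 -> (forall A, F0 A -> filter_prod F0 F0 A) ->
  exists p, ultrafilter p /\ (forall A, F0 A -> p A) /\ forall A, p A -> filter_prod p p A.
Proof.
  intros HF0 Hidem0.
  destruct (maximal_filter (fun F => forall A, F A -> filter_prod F F A)) with (F0 := F0)
    as [F [HF [Hidem [Hsub Hmax]]]]; auto.
  { intros C _ HC A [F [HF HA]]. exists F; split; [exact HF |].
    apply (filter_mono _ (proj1 (HC F HF)) (fun n => F (shift A n))).
    - apply HC; assumption.
    - intros n Hn. exists F; auto. }
  destruct (ultrafilter_extension F HF) as [q [[Hq Hultra] HFq]].
  assert (Hcompl : forall A, ~ q A -> q (fun n => ~ A n))
    by (intros A HA; destruct (Hultra A); tauto).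
  assert (Hnot : forall A, q (fun n => ~ A n) -> ~ q A).
  { intros A H1 H2. apply (filter_proper _ Hq).
    apply (filter_mono _ Hq _ _ (filter_and _ Hq _ _ H1 H2)). tauto. }
  assert (Hleft : forall A, F A -> filter_prod F q A).
  { intros A HA. apply (filter_mono _ HF _ _ (Hidem A HA)). intros n; apply HFq. }
  assert (HFqf : is_filter (filter_prod F q)).
  { split; unfold filter_prod.
    - apply (filter_mono _ HF _ _ (filter_true _ HF)). intros n _.
      apply (filter_true _ Hq).
    - intros A B HA HB. apply (filter_mono _ HF _ _ (filter_and _ HF _ _ HA HB)).
      intros n [H1 H2]. exact (filter_and _ Hq _ _ H1 H2).
    - intros A B HA HAB. apply (filter_mono _ HF _ _ HA).
      intros n H1. apply (filter_mono _ Hq _ _ H1). intros k; apply HAB.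
    - intro H. apply (filter_proper _ HF). apply (filter_mono _ HF _ _ H).
      intros n; apply (filter_proper _ Hq). }
  (* [filter_prod F q] extends [F] and is again contained in its own square, so maximality makes it
     equal to [F]. *)
  assert (HFq_eq : forall A, filter_prod F q A -> F A).
  { apply (Hmax (filter_prod F q)); [exact HFqf | | exact Hleft].
    intros A HA.
    apply (filter_mono _ HFqf (fun n => F (shift (fun n => q (shift A n)) n))).
    - apply Hleft, Hidem, HA.
    - intros n Hn. apply (filter_mono _ HF _ _ Hn). intros m Hm.
      rewrite shift_shift. exact Hm. }
  exists q. split; [split; assumption |]. split; [auto |].
  intros A HA. apply HFq.
  (* This filter describes the ultrafilters r extending [F] with r q = q. It is proper because
     [filter_prod F q] is [F], which [q] extends. By maximality it is [F], so [q] itself solves the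
     equation. *)
  apply (Hmax (fun E => exists D A, F D /\ q A /\ forall n, D n -> q (shift A n) -> E n)).
  - split.
    + exists (fun _ => True), (fun _ => True).
      split; [apply filter_true, HF | split; [apply filter_true, Hq | auto]].
    + intros E1 E2 [D1 [A1 [H1 [K1 I1]]]] [D2 [A2 [H2 [K2 I2]]]].
      exists (fun n => D1 n /\ D2 n), (fun n => A1 n /\ A2 n).
      split; [apply filter_and; auto | split; [apply filter_and; auto |]].
      intros n [X1 X2] X.
      split; [apply I1 | apply I2]; auto; apply (filter_mono _ Hq _ _ X); unfold shift; tauto.
    + intros E1 E2 [D1 [A1 [H1 [K1 I1]]]] H12. exists D1, A1; auto.
    + intros [D1 [A1 [H1 [K1 I1]]]].
      apply (Hnot A1); [| exact K1]. apply HFq, HFq_eq.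
      apply (filter_mono _ HF _ _ H1). intros n Dn. apply Hcompl.
      intro Hn. exact (I1 n Dn Hn).
  - intros E [D [A1 [H1 [K1 I1]]]].
    exists (fun n => F (shift D n)), A1. split; [apply Hidem, H1 | split; [exact K1 |]].
    intros n Dn An. exists (shift D n), (shift A1 n). split; [exact Dn | split; [exact An |]].
    intros m Dm Am. apply I1; [exact Dm |]. rewrite <- shift_shift. exact Am.
  - intros D HD. exists D, (fun _ => True).
    split; [exact HD | split; [apply filter_true, Hq | auto]].
  - exists (fun _ => True), A. split; [apply filter_true, HF | split; [exact HA | auto]].
Qed.

(** [idem_syndetic] is the trace of minimality. It is stated for [p]-many n at every offset [i],
    with one [L], so that it can be intersected with other large sets. *)
Record minimal_idempotent (p : (nat -> Prop) -> Prop) : Prop := {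
  idem_ultra : ultrafilter p;
  idem_cofinite : cofinite_filter p;
  idem_prod : forall A, p A -> filter_prod p p A;
  idem_syndetic : forall A, p A -> exists L, forall i,
    p (fun n => exists j, (j <= L)%nat /\ A (n + i + j)%nat) }.

Lemma minimal_idempotent_exists : exists p, minimal_idempotent p.
Proof.
  destruct minimal_left_ideal as [F [HF [Hcof [Hinv Hsynd]]]].
  destruct (idempotent_ultrafilter_extension F HF) as [p [Hp [HFp Hidem]]].
  (* All translates of a member of a shift-invariant filter are members, so [F] lies in its own
     square. *)
  { intros A HA. apply (filter_mono _ HF _ _ (filter_true _ HF)). intros n _.
    apply shift_invariant_iter; assumption. }
  exists p. split; [exact Hp | intro m; apply HFp, Hcof | exact Hidem |].
  intros A HA. destruct (Hsynd A) as [L HL].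
  - intro HnA. apply (filter_proper _ (proj1 Hp)).
    apply (filter_mono _ (proj1 Hp) _ _ (filter_and _ (proj1 Hp) _ _ HA (HFp _ HnA))). tauto.
  - exists L. intro i. apply HFp.
    apply (filter_mono _ HF _ _ (shift_invariant_iter _ _ i Hinv HL)).
    intros n [j [Hj HAj]]. exists j; split; [exact Hj |].
    replace (n + i + j)%nat with (i + n + j)%nat by lia. exact HAj.
Qed.

(** * Sets of positive density and thickly syndetic sets *)

Lemma le_list_max (l : list nat) a : In a l -> (a <= list_max l)%nat.
Proof.
  intro Ha. pose proof (proj1 (list_max_le l (list_max l)) (le_n _)) as H.
  rewrite Forall_forall in H. exact (H a Ha).
Qed.

Section UltrafilterRules.

Context (p : (nat -> Prop) -> Prop) (Hp : minimal_idempotent p).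

Lemma large_and A B : p A -> p B -> p (fun n => A n /\ B n).
Proof. apply filter_and, Hp. Qed.

Lemma large_mono (A B : nat -> Prop) : p A -> (forall n, A n -> B n) -> p B.
Proof. intros HA H. exact (filter_mono _ (proj1 (idem_ultra _ Hp)) A B HA H). Qed.

Lemma large_all (A : nat -> Prop) : (forall n, A n) -> p A.
Proof.
  intro HA. apply (large_mono _ _ (idem_cofinite _ Hp 0%nat)). auto.
Qed.

Lemma large_not A : ~ p A -> p (fun n => ~ A n).
Proof. intro HA. destruct (proj2 (idem_ultra _ Hp) A); tauto. Qed.

Lemma large_witness A m : p A -> exists n, (m <= n)%nat /\ A n.
Proof.
  intro HA. apply NNPP; intro Hno.
  apply (filter_proper _ (proj1 (idem_ultra _ Hp))).
  apply (large_mono _ _ (large_and _ _ HA (idem_cofinite _ Hp m))).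
  intros n [H1 H2]. apply Hno. exists n; auto.
Qed.

Lemma large_list (J : Type) (A : J -> nat -> Prop) (l : list J) :
  (forall j, In j l -> p (A j)) -> p (fun n => forall j, In j l -> A j n).
Proof.
  induction l as [| j l IH]; intro H.
  - apply large_all. intros n j [].
  - apply (large_mono _ _ (large_and _ _ (H j (or_introl eq_refl))
      (IH (fun i Hi => H i (or_intror Hi))))).
    intros n [H1 H2] i [<- | Hi]; auto.
Qed.

Lemma large_below (A : nat -> nat -> Prop) m :
  (forall i, (i < m)%nat -> p (A i)) -> p (fun n => forall i, (i < m)%nat -> A i n).
Proof.
  intro H. apply (large_mono (fun n => forall i, In i (seq 0 m) -> A i n)).
  - apply large_list. intros i Hi. apply H. apply in_seq in Hi; lia.
  - intros n Hn i Hi. apply Hn, in_seq; lia.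
Qed.

End UltrafilterRules.

Definition indicator (P : Prop) : R := if excluded_middle_informative P then 1 else 0.

Lemma indicator_true (P : Prop) : P -> indicator P = 1.
Proof. intro H. unfold indicator. destruct excluded_middle_informative; tauto. Qed.

Lemma indicator_false (P : Prop) : ~ P -> indicator P = 0.
Proof. intro H. unfold indicator. destruct excluded_middle_informative; tauto. Qed.

Fixpoint count (A : nat -> Prop) (n : nat) : R :=
  match n with O => 0 | S k => count A k + indicator (A k) end.

Lemma count_mono (A B : nat -> Prop) n : (forall i, A i -> B i) -> count A n <= count B n.
Proof.
  intro H. induction n as [| n IH]; simpl; [lra |].
  unfold indicator. do 2 destruct excluded_middle_informative; firstorder lra.
Qed.

Lemma count_or_and (A B : nat -> Prop) n :
  count (fun i => A i \/ B i) n + count (fun i => A i /\ B i) n = count A n + count B n.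
Proof.
  induction n as [| n IH]; simpl; [lra |].
  unfold indicator. repeat destruct excluded_middle_informative; (lra || tauto).
Qed.

Lemma count_bounds A n : 0 <= count A n <= INR n.
Proof.
  induction n as [| n IH]; [simpl; lra |]. rewrite S_INR. simpl.
  unfold indicator. destruct excluded_middle_informative; lra.
Qed.

Lemma count_shift_one A n : count (shift A 1) n = count A n + indicator (A n) - indicator (A 0%nat).
Proof.
  induction n as [| n IH]; simpl; [lra |]. rewrite IH. unfold shift. simpl. lra.
Qed.

Lemma count_shift A b n : Rabs (count (shift A b) n - count A n) <= INR b.
Proof.
  induction b as [| b IH].
  - change (shift A 0) with A. rewrite Rminus_diag, Rabs_R0. simpl; lra.
  - replace (S b) with (b + 1)%nat at 1 by lia. rewrite <- shift_shift, count_shift_one, S_INR.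
    revert IH. unfold indicator, Rabs.
    repeat destruct excluded_middle_informative; repeat destruct Rcase_abs; lra.
Qed.

Lemma linear_eventually_above c b : 0 < c -> exists m, forall n, (m <= n)%nat -> b <= c * INR n.
Proof.
  intro Hc. destruct (INR_archimed c b Hc) as [m Hm]. exists m. intros n Hn.
  apply le_INR in Hn. nra.
Qed.

Definition thickly_syndetic (N : nat -> Prop) : Prop :=
  forall l, exists L, forall a, exists e,
    (a <= e)%nat /\ (e + l <= a + L)%nat /\ forall i, (i <= l)%nat -> N (e + i)%nat.

Section Density.

Context (p : (nat -> Prop) -> Prop) (Hp : minimal_idempotent p).

(** Density is taken along [p]: every set is then either null or positive, and the null sets form a
    shift-invariant ideal. *)
Definition null_density (A : nat -> Prop) : Prop :=
  forall c, 0 < c -> p (fun n => count A n <= c * INR n).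

Definition pos_density (A : nat -> Prop) : Prop :=
  exists c, 0 < c /\ p (fun n => c * INR n <= count A n).

Lemma pos_density_of_not_null A : ~ null_density A -> pos_density A.
Proof.
  intro H. apply not_all_ex_not in H as [c H]. apply imply_to_and in H as [Hc H].
  exists c; split; [exact Hc |].
  apply (large_mono p Hp _ _ (large_not p Hp _ H)). intros n Hn; lra.
Qed.

Lemma pos_density_not_null A : pos_density A -> ~ null_density A.
Proof.
  intros [c [Hc H]] Hn.
  destruct (large_witness p Hp _ 1 (large_and p Hp _ _ H (Hn (c / 2) ltac:(lra))))
    as [n [Hn1 [H1 H2]]].
  apply le_INR in Hn1. simpl in Hn1. nra.
Qed.

Lemma null_density_mono (A B : nat -> Prop) :
  (forall i, A i -> B i) -> null_density B -> null_density A.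
Proof.
  intros H HB c Hc. apply (large_mono p Hp _ _ (HB c Hc)). intros n Hn.
  pose proof (count_mono A B n H). lra.
Qed.

Lemma pos_density_mono (A B : nat -> Prop) :
  (forall i, A i -> B i) -> pos_density A -> pos_density B.
Proof.
  intros H HA. apply pos_density_of_not_null. intro HB.
  exact (pos_density_not_null A HA (null_density_mono A B H HB)).
Qed.

Lemma null_density_or A B :
  null_density A -> null_density B -> null_density (fun i => A i \/ B i).
Proof.
  intros HA HB c Hc.
  apply (large_mono p Hp _ _
    (large_and p Hp _ _ (HA (c / 2) ltac:(lra)) (HB (c / 2) ltac:(lra)))).
  intros n [H1 H2]. pose proof (count_or_and A B n).
  pose proof (count_bounds (fun i => A i /\ B i) n). lra.
Qed.

Lemma null_density_empty : null_density (fun _ => False).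
Proof.
  intros c Hc. apply large_all; [exact Hp |]. intro n.
  assert (count (fun _ => False) n = 0) as ->.
  { induction n as [| n IH]; [reflexivity |]. simpl. rewrite indicator_false; lra || tauto. }
  pose proof (pos_INR n). nra.
Qed.

Lemma null_density_list (J : Type) (A : J -> nat -> Prop) (l : list J) :
  (forall j, In j l -> null_density (A j)) ->
  null_density (fun n => exists j, In j l /\ A j n).
Proof.
  induction l as [| j l IH]; intro H.
  - apply (null_density_mono _ (fun _ => False)); [| exact null_density_empty].
    intros n [j [[] _]].
  - eapply null_density_mono;
      [| exact (null_density_or _ _ (H j (or_introl eq_refl))
                 (IH (fun i Hi => H i (or_intror Hi))))].
    intros n [i [[<- | Hi] Hn]]; [left; exact Hn | right; exists i; auto].
Qed.

Lemma null_density_shift A b : null_density (shift A b) <-> null_density A.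
Proof.
  split; intros H c Hc;
    (destruct (linear_eventually_above (c / 2) (INR b) ltac:(lra)) as [m Hm];
     apply (large_mono p Hp _ _ (large_and p Hp _ _ (H (c / 2) ltac:(lra))
       (idem_cofinite p Hp m)));
     intros n [H1 H2]; specialize (Hm n H2); pose proof (count_shift A b n) as Hs;
     unfold Rabs in Hs; destruct Rcase_abs; lra).
Qed.

Lemma null_density_below m : null_density (fun n => (n < m)%nat).
Proof.
  apply (null_density_shift _ m).
  apply (null_density_mono _ (fun _ => False)); [| exact null_density_empty].
  unfold shift. intros i Hi. lia.
Qed.

(* Otherwise the union of r shifts of [A] by entries of [a] would have density
   at least r c, where c is the density of [A]. *)
Lemma pos_density_differences A (a : nat -> nat) :
  (forall i j, (i < j)%nat -> (a i < a j)%nat) -> pos_density A ->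
  p (fun i => p (fun j => pos_density (fun n => A n /\ A (a j - a i + n)%nat))).
Proof.
  intros Hmono Hpos. apply NNPP; intro Hbad. apply (large_not p Hp) in Hbad.
  set (bad := fun i => p (fun j => null_density (fun n => A n /\ A (a j - a i + n)%nat))).
  assert (Hbad' : p bad).
  { apply (large_mono p Hp _ _ Hbad). intros i Hi.
    apply (large_mono p Hp _ _ (large_not p Hp _ Hi)). intros j Hj.
    apply NNPP; intro H. apply Hj, pos_density_of_not_null, H. }
  destruct Hpos as [c [Hc HA]].
  assert (Hr : forall r, exists l, (forall i, In i l -> bad i) /\ forall eps, 0 < eps ->
    p (fun n => (INR r * c - eps) * INR n
                <= count (fun k => exists i, In i l /\ A (a i + k)%nat) n)).
  { induction r as [| r [l [Hl HU]]].
    - exists []. split; [intros i [] |]. intros eps Heps. apply large_all; [exact Hp |].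
      intro n. pose proof (count_bounds (fun k => exists i, In i [] /\ A (a i + k)%nat) n).
      simpl INR. pose proof (pos_INR n). nra.
    - set (U := fun k => exists i, In i l /\ A (a i + k)%nat) in *.
      pose proof (large_and p Hp _ _ Hbad' (large_list p Hp _ _ l Hl)) as Hj.
      (* [j] lies beyond all of [l] and forms a null pair with each entry, so the new translate
         meets the old union in a null set and adds a full [c] to its density. *)
      destruct (large_witness p Hp _ (S (list_max l)) Hj) as [j [Hlj [Hbj Hij]]].
      exists (j :: l). split; [intros i [<- | Hi]; auto |].
      assert (Hint : null_density (fun k => A (a j + k)%nat /\ U k)).
      { apply (null_density_mono _
          (fun k => exists i, In i l /\ shift (fun n => A n /\ A (a j - a i + n)%nat) (a i) k)).
        - intros k [H1 [i [Hi H2]]]. exists i; split; [exact Hi |].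
          assert (a i < a j)%nat.
          { apply Hmono. pose proof (le_list_max l i Hi). lia. }
          unfold shift. split; [exact H2 |].
          replace (a j - a i + (a i + k))%nat with (a j + k)%nat by lia. exact H1.
        - apply null_density_list. intros i Hi. apply null_density_shift. exact (Hij i Hi). }
      intros eps Heps.
      destruct (linear_eventually_above (eps / 3) (INR (a j)) ltac:(lra)) as [m Hm].
      apply (large_mono p Hp _ _ (large_and p Hp _ _ (large_and p Hp _ _ HA
        (HU (eps / 3) ltac:(lra))) (large_and p Hp _ _ (Hint (eps / 3) ltac:(lra))
        (idem_cofinite p Hp m)))).
      intros n [[H1 H2] [H3 H4]]. specialize (Hm n H4).
      pose proof (count_shift A (a j) n) as Hs.
      pose proof (count_or_and (shift A (a j)) U n) as Hor.
      assert (count (fun i => shift A (a j) i \/ U i) n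
        <= count (fun k => exists i, In i (j :: l) /\ A (a i + k)%nat) n) as Hle.
      { apply count_mono. intros k [Hk | [i [Hi Hk]]]; [exists j | exists i]; simpl; auto. }
      change (fun i => shift A (a j) i /\ U i) with (fun k => A (a j + k)%nat /\ U k) in Hor.
      rewrite S_INR. unfold Rabs in Hs. destruct Rcase_abs; lra. }
  (* With r c > 2 and an error of 1/2 the union would have density at least 3/2. *)
  destruct (INR_archimed c 2 Hc) as [r Hrc].
  destruct (Hr r) as [l [_ HU]].
  destruct (large_witness p Hp _ 1 (HU (1 / 2) ltac:(lra))) as [n [Hn HUn]].
  pose proof (count_bounds (fun k => exists i, In i l /\ A (a i + k)%nat) n).
  apply le_INR in Hn. simpl INR in Hn.
  assert (3 / 2 * INR n <= (INR r * c - 1 / 2) * INR n) by (apply Rmult_le_compat_r; lra).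
  lra.
Qed.

(** If the common return times had unbounded gaps, a sequence whose differences all fall into gaps
    would contradict [pos_density_differences]. *)
Lemma common_returns_syndetic (As : list (nat -> Prop)) :
  (forall A, In A As -> pos_density A) ->
  exists g, forall e, exists b, (e <= b <= e + g)%nat /\
    forall A, In A As -> pos_density (fun n => A n /\ A (b + n)%nat).
Proof.
  intro HAs. apply NNPP; intro Hno.
  assert (Hgap : forall g, exists e, forall b, (e <= b <= e + g)%nat ->
    ~ forall A, In A As -> pos_density (fun n => A n /\ A (b + n)%nat)).
  { intro g. apply NNPP; intro H. apply Hno. exists g. intro e.
    apply NNPP; intro H'. apply H. exists e. intros b Hb Hr. apply H'. exists b; auto. }
  apply choice in Hgap as [gap Hgap].
  (* The term after [a k] is [a k] plus one more than the start of a gap of length [S (a k)], so its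
     differences with all earlier terms lie in that gap. *)
  set (a := fix a i := match i with O => O | S k => (S (gap (S (a k))) + a k)%nat end).
  assert (Hstep : forall i, (a i < a (S i))%nat) by (intro i; simpl; lia).
  assert (Hmono : forall i j, (i < j)%nat -> (a i < a j)%nat).
  { intros i j Hij. induction Hij; [apply Hstep |].
    pose proof (Hstep m). lia. }
  assert (Hall : p (fun i => forall A, In A As ->
    p (fun j => pos_density (fun n => A n /\ A (a j - a i + n)%nat)))).
  { apply large_list; [exact Hp |]. intros A HA. apply pos_density_differences; auto. }
  destruct (large_witness p Hp _ 0 Hall) as [i [_ Hi]].
  destruct (large_witness p Hp _ (S i) (large_list p Hp _ _ As Hi)) as [j [Hij Hj]].
  destruct j as [| j]; [lia |].
  apply (Hgap (S (a j)) (a (S j) - a i)%nat); [| exact Hj].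
  assert (a i <= a j)%nat.
  { destruct (Nat.eq_dec i j) as [-> | Hne]; [lia |].
    pose proof (Hmono i j ltac:(lia)). lia. }
  assert (a (S j) = S (gap (S (a j)) + a j)) by reflexivity. lia.
Qed.

(* If no such [b] exists, then some late element a of [G] has a - b outside [N]
   for all return times b up to a given bound; these return times are syndetic
   whereas [N] contains long intervals close to a. *)
Lemma return_into_thickly_syndetic (As : list (nat -> Prop)) G N :
  (forall A, In A As -> pos_density A) -> pos_density G -> thickly_syndetic N ->
  exists b, (forall A, In A As -> pos_density (fun n => A n /\ A (b + n)%nat)) /\
    pos_density (fun n => N n /\ G (b + n)%nat).
Proof.
  intros HAs HG HN. apply NNPP; intro Hno.
  destruct (common_returns_syndetic As HAs) as [g Hg].
  destruct (HN g) as [L HL].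
  set (Z := fun b => forall A, In A As -> pos_density (fun n => A n /\ A (b + n)%nat)).
  apply (pos_density_not_null G HG).
  set (bad := fun b n => (b <= n)%nat /\ Z b /\ G n /\ N (n - b)%nat).
  apply (null_density_mono _ (fun n => (n < L)%nat \/ exists b, In b (seq 0 (S L)) /\ bad b n)).
  - intros n HGn. destruct (Nat.lt_ge_cases n L) as [H | H]; [left; exact H | right].
    destruct (HL (n - L)%nat) as [e [He1 [He2 HNe]]].
    (* [n - b] then falls into the interval from [e] to [e + g] inside [N], and [b <= L] because
       [n - L <= e]. *)
    destruct (Hg (n - e - g)%nat) as [b [Hb HZ]].
    exists b. split; [apply in_seq; lia |]. unfold bad.
    split; [lia | split; [exact HZ | split; [exact HGn |]]].
    replace (n - b)%nat with (e + (n - b - e))%nat by lia. apply HNe. lia.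
  - apply null_density_or; [apply null_density_below |].
    apply null_density_list. intros b _.
    destruct (classic (Z b)) as [HZ | HZ].
    + apply (null_density_shift _ b).
      apply (null_density_mono _ (fun n => N n /\ G (b + n)%nat)).
      * unfold shift, bad. intros n [_ [_ [H1 H2]]].
        replace (b + n - b)%nat with n in H2 by lia. auto.
      * apply NNPP; intro H. apply Hno. exists b. split; [exact HZ |].
        apply pos_density_of_not_null, H.
    + apply (null_density_mono _ (fun _ => False)); [| exact null_density_empty].
      unfold bad; tauto.
Qed.

(** A vertex of the Hilbert cube generated by [l]. Coordinates count from the end of the list, so
    that consing a generator keeps the old ones. *)
Fixpoint cube (l : list nat) (s : nat -> bool) : nat :=
  match l with
  | [] => 0
  | b :: l' => (if s (length l') then b else 0) + cube l' s
  end.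

Lemma cube_bound l s : (cube l s <= list_sum l)%nat.
Proof. induction l as [| b l IH]; simpl; [lia |]. destruct (s (length l)); lia. Qed.

(** Each step adds a common return time [b] of all sets built so far that also carries, with
    positive density, times whose whole old cube lies in [N] into [G]. At these times the face
    without [b] lies in [N] and the face with [b] in [F]. *)
Lemma cube_shatters F N m :
  pos_density F -> thickly_syndetic N ->
  exists l, length l = m /\ pos_density (fun t => forall s, F (t + cube l s)%nat) /\
    forall i, (i < m)%nat -> pos_density (fun t => forall s,
      (s i = true -> F (t + cube l s)%nat) /\ (s i = false -> N (t + cube l s)%nat)).
Proof.
  intros HF HN. induction m as [| m [l [Hl [HG HS]]]].
  - exists []. split; [reflexivity | split; [| intros i Hi; lia]].
    apply (pos_density_mono F); [| exact HF]. intros t Ht s. simpl.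
    replace (t + 0)%nat with t by lia. exact Ht.
  - set (G := fun t => forall s, F (t + cube l s)%nat) in *.
    set (A := fun i t => forall s,
      (s i = true -> F (t + cube l s)%nat) /\ (s i = false -> N (t + cube l s)%nat)) in *.
    destruct (return_into_thickly_syndetic (G :: map A (seq 0 m)) G
      (fun t => forall s, N (t + cube l s)%nat)) as [b [Hret HNG]].
    + intros E [<- | HE]; [exact HG |].
      apply in_map_iff in HE as [i [<- Hi]]. apply HS. apply in_seq in Hi; lia.
    + exact HG.
    (* The old cube has diameter at most [list_sum l], so intervals of [N] longer by that amount
       suffice. *)
    + intro k. destruct (HN (k + list_sum l)%nat) as [L HL]. exists L. intro a.
      destruct (HL a) as [e [He1 [He2 HNe]]]. exists e. split; [exact He1 | split; [lia |]].
      intros i Hi s. rewrite <- Nat.add_assoc. apply HNe. pose proof (cube_bound l s); lia.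
    + assert (Hcons : forall t s, (t + cube (b :: l) s =
        (if s m then b + t else t) + cube l s)%nat).
      { intros t s. simpl. rewrite Hl. destruct (s m); lia. }
      exists (b :: l). split; [simpl; lia | split].
      * refine (pos_density_mono _ _ _ (Hret G (or_introl eq_refl))).
        intros t [H1 H2] s. rewrite Hcons. destruct (s m); auto.
      * intros i Hi. destruct (Nat.eq_dec i m) as [-> | Him].
        -- refine (pos_density_mono _ _ _ HNG). intros t [H1 H2] s. rewrite Hcons.
           destruct (s m); split; intro H; (discriminate || auto).
        -- refine (pos_density_mono _ _ _ (Hret (A i) _)).
           ++ intros t [H1 H2] s. rewrite Hcons. destruct (s m); auto.
           ++ right. apply in_map, in_seq. lia.
Qed.

(** Each coordinate [i] contributes a base point [t i]; the vertex selected by [s] becomes the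
    common time [n s]. *)
Lemma density_independence F N m :
  pos_density F -> thickly_syndetic N ->
  exists (n : (nat -> bool) -> nat) (t : nat -> nat), forall s i, (i < m)%nat ->
    (s i = true -> F (t i + n s)%nat) /\ (s i = false -> N (t i + n s)%nat).
Proof.
  intros HF HN. destruct (cube_shatters F N m HF HN) as [l [_ [_ HS]]].
  assert (H : forall i, exists t, (i < m)%nat -> forall s,
    (s i = true -> F (t + cube l s)%nat) /\ (s i = false -> N (t + cube l s)%nat)).
  { intro i. destruct (classic (i < m)%nat) as [Hi | Hi]; [| exists 0%nat; tauto].
    apply NNPP; intro Hno. apply (pos_density_not_null _ (HS i Hi)).
    refine (null_density_mono _ _ _ null_density_empty).
    intros t Ht. apply Hno. exists t. auto. }
  apply choice in H as [t Ht]. exists (cube l), t. intros s i Hi. exact (Ht i Hi s).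
Qed.

End Density.

(** * Null systems realise boundedly many patterns *)

Lemma binary_code k (f : nat -> bool) :
  exists j, (j < 2 ^ k)%nat /\ forall i, (i < k)%nat -> Nat.testbit j i = f i.
Proof.
  revert f. induction k as [| k IH]; intro f.
  - exists 0%nat. simpl. split; [lia | intros i Hi; lia].
  - destruct (IH (fun i => f (S i))) as [j [Hj Hf]].
    exists (2 * j + Nat.b2n (f 0%nat))%nat. split.
    + simpl. destruct (f 0%nat); simpl; lia.
    + intros [| i] Hi.
      * apply Nat.testbit_0_r.
      * rewrite Nat.testbit_succ_r. apply Hf. lia.
Qed.

Lemma binary_code_inj k a b :
  (a < 2 ^ k)%nat -> (b < 2 ^ k)%nat ->
  (forall i, (i < k)%nat -> Nat.testbit a i = Nat.testbit b i) -> a = b.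
Proof.
  intros Ha Hb H. apply Nat.bits_inj. intro i.
  destruct (Nat.lt_ge_cases i k) as [Hi | Hi]; [apply H, Hi |].
  rewrite <- (Nat.mod_small a (2 ^ k)), <- (Nat.mod_small b (2 ^ k)) by assumption.
  rewrite !Nat.mod_pow2_bits_high by assumption. reflexivity.
Qed.

Lemma StronglySorted_seq a n : StronglySorted lt (seq a n).
Proof.
  revert a. induction n as [| n IH]; intro a; simpl; constructor; [apply IH |].
  apply Forall_forall. intros i Hi. apply in_seq in Hi. lia.
Qed.

Lemma StronglySorted_filter (f : nat -> bool) l :
  StronglySorted lt l -> StronglySorted lt (filter f l).
Proof.
  intro H. induction H as [| a l H IH Ha]; simpl; [constructor |].
  destruct (f a); [constructor; [exact IH |] | exact IH].
  apply Forall_forall. intros i Hi. apply filter_In in Hi.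
  rewrite Forall_forall in Ha. apply Ha, Hi.
Qed.

Lemma StronglySorted_app (l1 l2 : list nat) :
  StronglySorted lt l1 -> StronglySorted lt l2 ->
  (forall a b, In a l1 -> In b l2 -> (a < b)%nat) -> StronglySorted lt (l1 ++ l2).
Proof.
  intros H1 H2 H12. induction H1 as [| a l H IH Ha]; simpl; [exact H2 |].
  constructor.
  - apply IH. intros; apply H12; [right |]; assumption.
  - apply Forall_app. split; [exact Ha |]. apply Forall_forall.
    intros b Hb. apply H12; [left; reflexivity | exact Hb].
Qed.

Lemma StronglySorted_nth (l : list nat) i :
  StronglySorted lt l -> (S i < length l)%nat -> (nth i l 0 < nth (S i) l 0)%nat.
Proof.
  intro H. revert i. induction H as [| a l H IH Ha]; intros i Hi; simpl in Hi; [lia |].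
  destruct i as [| i].
  - rewrite Forall_forall in Ha. apply Ha. apply (nth_In l 0%nat). lia.
  - change (nth (S i) (a :: l) 0%nat) with (nth i l 0%nat).
    change (nth (S (S i)) (a :: l) 0%nat) with (nth (S i) l 0%nat). apply IH. lia.
Qed.

Lemma least_nat (P : nat -> Prop) :
  (exists n, P n) -> exists n, P n /\ forall m, P m -> (n <= m)%nat.
Proof.
  intros [n Hn]. revert Hn. induction n as [n IH] using (well_founded_induction Wf_nat.lt_wf).
  intro Hn. destruct (classic (exists m, (m < n)%nat /\ P m)) as [[m [Hm HP]] | H].
  - exact (IH m Hm HP).
  - exists n. split; [exact Hn |]. intros m Hm.
    destruct (Nat.lt_ge_cases m n) as [Hlt | Hge]; [| exact Hge].
    exfalso. apply H. exists m; auto.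
Qed.

(** Each block is longer than everything before it, so it fills more than half of an initial segment
    of [A] and its complexity is not averaged away in the entropy. *)
Lemma block_sequence (Q : list nat -> Prop) :
  (forall B K, exists J, StronglySorted lt J /\ (forall t, In t J -> (B < t)%nat) /\
     (K <= length J)%nat /\ Q J) ->
  exists A, (forall i, (A i < A (S i))%nat) /\
    forall k, exists J m, Q J /\ (k <= m)%nat /\ (m < length J)%nat /\
      forall i, (i < length J)%nat -> nth i J 0%nat = A (m + i)%nat.
Proof.
  intro HQ.
  assert (H : forall l : list nat, exists J, StronglySorted lt J /\
    (forall t, In t J -> (list_max l < t)%nat) /\ (S (length l) <= length J)%nat /\ Q J)
    by (intro l; apply HQ).
  apply choice in H as [ext Hext].
  set (chain := fix chain k := match k with O => [] | S k => chain k ++ ext (chain k) end).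
  assert (HchainS : forall k, chain (S k) = chain k ++ ext (chain k)) by reflexivity.
  assert (Hlen : forall k, (k <= length (chain k))%nat).
  { induction k as [| k IH]; [lia |]. rewrite HchainS, length_app.
    destruct (Hext (chain k)) as [_ [_ [H _]]]. lia. }
  assert (Hsorted : forall k, StronglySorted lt (chain k)).
  { induction k as [| k IH]; [constructor |]. rewrite HchainS.
    destruct (Hext (chain k)) as [H1 [H2 _]]. apply StronglySorted_app; auto.
    intros a b Ha Hb. pose proof (le_list_max _ _ Ha). pose proof (H2 b Hb). lia. }
  assert (Hgrow : forall k k', (k <= k')%nat -> (length (chain k) <= length (chain k'))%nat).
  { intros k k' Hk. induction Hk; [lia |]. rewrite HchainS, length_app. lia. }
  assert (Hnth : forall i k k', (k <= k')%nat -> (i < length (chain k))%nat ->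
    nth i (chain k') 0%nat = nth i (chain k) 0%nat).
  { intros i k k' Hk Hi. induction Hk as [| k' Hk IH]; [reflexivity |].
    rewrite HchainS, app_nth1; [exact IH |]. pose proof (Hgrow k k' Hk). lia. }
  (* [chain (S i)] has more than [i] entries, so the default 0 is never read. *)
  set (A := fun i => nth i (chain (S i)) 0%nat).
  assert (HA : forall i k, (i < length (chain k))%nat -> nth i (chain k) 0%nat = A i).
  { intros i k Hi. unfold A. destruct (Nat.le_ge_cases k (S i)) as [H | H].
    - symmetry. apply Hnth; assumption.
    - apply Hnth; [assumption |]. pose proof (Hlen (S i)). lia. }
  exists A. split.
  - intro i. pose proof (Hlen (S (S i))).
    rewrite <- (HA i (S (S i))), <- (HA (S i) (S (S i))) by lia.
    apply StronglySorted_nth; [apply Hsorted | lia].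
  - intro k. exists (ext (chain k)), (length (chain k)).
    destruct (Hext (chain k)) as [_ [_ [H3 H4]]].
    split; [exact H4 | split; [apply Hlen | split; [lia |]]].
    intros i Hi. rewrite <- (HA _ (S k)), HchainS.
    + rewrite app_nth2 by lia. f_equal. lia.
    + rewrite HchainS, length_app. lia.
Qed.

Section Separation.

Context {X : Type} (d : X -> X -> R) (T : X -> X) (Hsys : dyn_system d T).

Lemma dist_pos x y : 0 <= d x y.
Proof. apply Hsys. Qed.

Lemma dist_refl x : d x x = 0.
Proof. apply Hsys. reflexivity. Qed.

Lemma dist_sym x y : d x y = d y x.
Proof. apply Hsys. Qed.

Lemma dist_triangle x y z : d x z <= d x y + d y z.
Proof. apply Hsys. Qed.

Definition dist_at (t : nat) (x y : X) : R := d (Nat.iter t T x) (Nat.iter t T y).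

Definition coded (e1 e2 : R) (b : bool) (r : R) : Prop :=
  (b = true -> e2 <= r) /\ (b = false -> r <= e1).

Lemma coded_unique e1 e2 b b' r : e1 < e2 -> coded e1 e2 b r -> coded e1 e2 b' r -> b = b'.
Proof.
  intros He [H1 H2] [H3 H4].
  destruct b, b'; try reflexivity;
    [pose proof (H1 eq_refl); pose proof (H4 eq_refl)
    | pose proof (H2 eq_refl); pose proof (H3 eq_refl)]; lra.
Qed.

Definition shatters e1 e2 (m : nat) (x y : nat -> X) : Prop :=
  forall s : nat -> bool, exists t, forall j, (j < m)%nat ->
    coded e1 e2 (s j) (dist_at t (x j) (y j)).

Definition independent e1 e2 (l : list nat) : Prop :=
  forall s : nat -> bool, exists x y, forall t, In t l -> coded e1 e2 (s t) (dist_at t x y).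

(** Duality: the [2 ^ k] pairs are indexed by binary words, and [t i] is a time at which each pair
    shows the [i]-th bit of its index. The pair indexed by a word then realises that word along the
    times [t i]. *)
Lemma independent_of_shatters e1 e2 k x y :
  e1 < e2 -> shatters e1 e2 (2 ^ k) x y ->
  exists l, NoDup l /\ length l = k /\ independent e1 e2 l.
Proof.
  intros He H.
  assert (Ht : forall i, exists t, forall j, (j < 2 ^ k)%nat ->
    coded e1 e2 (Nat.testbit j i) (dist_at t (x j) (y j)))
    by (intro i; exact (H (fun j => Nat.testbit j i))).
  apply choice in Ht as [t Ht]. exists (map t (seq 0 k)). split; [| split].
  - apply Injective_map_NoDup_in; [| apply seq_NoDup].
    intros i i' Hi Hi' Heq. apply in_seq in Hi. apply in_seq in Hi'.
    (* The pair whose index has only bit [i] set tells [t i] from [t i']. *)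
    destruct (binary_code k (Nat.eqb i)) as [j [Hj Hbit]].
    pose proof (Ht i j Hj) as H1. pose proof (Ht i' j Hj) as H2. rewrite Heq in H1.
    pose proof (coded_unique _ _ _ _ _ He H1 H2) as Hb.
    rewrite !Hbit in Hb by lia. rewrite Nat.eqb_refl in Hb.
    apply Nat.eqb_eq. symmetry. exact Hb.
  - rewrite length_map, length_seq. reflexivity.
  - intro s. destruct (binary_code k (fun i => s (t i))) as [j [Hj Hbit]].
    exists (x j), (y j). intros u Hu. apply in_map_iff in Hu as [i [<- Hi]].
    apply in_seq in Hi. rewrite <- Hbit by lia. apply Ht, Hj.
Qed.

(** Independence passes to subsets, and at most [S B] of the distinct times are at most [B];
    filtering an interval of integers returns the others in order. *)
Lemma independent_late_block e1 e2 B k l :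
  NoDup l -> length l = (S B + k)%nat -> independent e1 e2 l ->
  exists J, StronglySorted lt J /\ (forall t, In t J -> (B < t)%nat) /\
    (k <= length J)%nat /\ independent e1 e2 J.
Proof.
  intros Hnd Hlen Hind.
  set (keep := fun t => if in_dec Nat.eq_dec t l then true else false).
  assert (Hkeep : forall t, keep t = true <-> In t l).
  { intro t. unfold keep. destruct (in_dec Nat.eq_dec t l); split; auto; discriminate. }
  exists (filter keep (seq (S B) (list_max l))). split; [| split; [| split]].
  - apply StronglySorted_filter, StronglySorted_seq.
  - intros t Ht. apply filter_In in Ht as [Ht _]. apply in_seq in Ht. lia.
  - assert (length l <= length (seq 0 (S B) ++ filter keep (seq (S B) (list_max l))))%nat.
    { apply NoDup_incl_length; [exact Hnd |]. intros t Ht. apply in_or_app.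
      pose proof (le_list_max _ _ Ht).
      destruct (Nat.lt_ge_cases t (S B)); [left; apply in_seq; lia | right].
      apply filter_In. split; [apply in_seq; lia | apply Hkeep, Ht]. }
    rewrite length_app, length_seq in H. lia.
  - intro s. destruct (Hind s) as [x [y Hxy]]. exists x, y. intros t Ht.
    apply Hxy, Hkeep. apply filter_In in Ht. apply Ht.
Qed.

Lemma finite_ball_cover r : 0 < r -> exists C, forall x, exists c, In c C /\ d c x < r.
Proof.
  intro Hr. destruct Hsys as [_ [Hcomp _]].
  destruct (Hcomp X (fun c x => d c x < r)) as [C HC].
  - intros c x Hx. exists (r - d c x). split; [lra |]. intros y Hy.
    pose proof (dist_triangle c x y). lra.
  - intro x. exists x. rewrite dist_refl. exact Hr.
  - exists C. exact HC.
Qed.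

Lemma join_subcover_exists U A n :
  finite_open_cover d U -> exists ws, join_subcover T U A n ws.
Proof.
  intros [_ HU]. induction n as [| n [ws [Hvalid Hcov]]].
  - exists [fun _ => 0%nat]. split.
    + intros w _ i Hi; lia.
    + intro x. exists (fun _ => 0%nat). split; [left; reflexivity | intros i Hi; lia].
  - exists (flat_map (fun w => map (fun c i => if Nat.eqb i n then c else w i)
      (seq 0 (length U))) ws). split.
    + intros w Hw i Hi. apply in_flat_map in Hw as [w' [Hw' Hw]].
      apply in_map_iff in Hw as [c [<- Hc]]. apply in_seq in Hc.
      destruct (Nat.eqb_spec i n); [lia |]. apply Hvalid; [exact Hw' | lia].
    + intro x. destruct (Hcov x) as [w [Hw Hx]].
      destruct (HU (Nat.iter (A n) T x)) as [V [HV HVx]].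
      destruct (In_nth U V empty_set HV) as [c [Hc <-]].
      exists (fun i => if Nat.eqb i n then c else w i). split.
      * apply in_flat_map. exists w; split; [exact Hw |].
        apply in_map_iff. exists c; split; [reflexivity | apply in_seq; lia].
      * intros i Hi. destruct (Nat.eqb_spec i n) as [-> | Hne]; [exact HVx |].
        apply Hx. lia.
Qed.

Lemma is_join_N_exists U A n :
  finite_open_cover d U -> exists k, is_join_N T U A n k.
Proof.
  intro HU. destruct (least_nat (fun k => exists ws, join_subcover T U A n ws /\ length ws = k))
    as [k [Hk Hmin]].
  - destruct (join_subcover_exists U A n HU) as [ws Hws]. exists (length ws), ws; auto.
  - exists k. split; [exact Hk |]. intros ws Hws. apply Hmin. exists ws; auto.
Qed.

(* Pairs of points in the same member of the join, for both coordinates, have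
   the same far/close pattern along the block, so a subcover with n members
   accounts for at most n^2 patterns. *)
Lemma independent_subcover_bound e1 e2 r C A n m J ws :
  4 * r <= e2 - e1 -> NoDup J -> independent e1 e2 J ->
  (forall i, (i < length J)%nat -> nth i J 0%nat = A (m + i)%nat) ->
  (m + length J <= n)%nat ->
  join_subcover T (map (fun c x => d c x < r) C) A n ws ->
  (2 ^ length J <= length ws * length ws)%nat.
Proof.
  intros Hr Hnd Hind HJ Hn [Hvalid Hcov].
  (* Points of one member are [2 * r]-close along the block, so exchanging both points of a pair
     moves its distance by less than [4 * r], too little to cross from [e1] to [e2]. *)
  set (U := map (fun c x => d c x < r) C) in *.
  assert (Hsame : forall w x x' i, join_member T U A n w x -> join_member T U A n w x' ->
    valid_index U n w -> (i < length J)%nat -> dist_at (nth i J 0%nat) x x' < 2 * r).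
  { intros w x x' i Hx Hx' Hw Hi. unfold dist_at. rewrite (HJ i Hi).
    specialize (Hx (m + i)%nat ltac:(lia)). specialize (Hx' (m + i)%nat ltac:(lia)).
    specialize (Hw (m + i)%nat ltac:(lia)).
    pose proof (nth_In U empty_set Hw) as HU. apply in_map_iff in HU as [c [HU _]].
    rewrite <- HU in Hx, Hx'.
    pose proof (dist_triangle (Nat.iter (A (m + i)%nat) T x) c (Nat.iter (A (m + i)%nat) T x')).
    rewrite (dist_sym _ c) in H. lra. }
  assert (Hpair : forall a, exists ww : (nat -> nat) * (nat -> nat), exists x y,
    In (fst ww) ws /\ In (snd ww) ws /\
    join_member T U A n (fst ww) x /\ join_member T U A n (snd ww) y /\
    forall i, (i < length J)%nat ->
      coded e1 e2 (Nat.testbit a i) (dist_at (nth i J 0%nat) x y)).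
  { intro a.
    (* Patterns are indexed by times but bits by positions in [J]; [NoDup J] makes the translation
       unambiguous. *)
    destruct (Hind (fun t => existsb (fun i => Nat.eqb (nth i J 0%nat) t && Nat.testbit a i)%bool
      (seq 0 (length J)))) as [x [y Hxy]].
    destruct (Hcov x) as [w [Hw Hwx]]. destruct (Hcov y) as [w' [Hw' Hwy]].
    exists (w, w'), x, y. do 4 (split; [assumption |]). intros i Hi.
    specialize (Hxy _ (nth_In J 0%nat Hi)).
    match goal with H : coded _ _ ?b _ |- _ => replace b with (Nat.testbit a i) in H end;
      [exact Hxy |].
    apply Bool.eq_iff_eq_true. rewrite existsb_exists. split.
    - intro Hbit. exists i. rewrite Nat.eqb_refl, Hbit. split; [apply in_seq; lia | reflexivity].
    - intros [i' [Hi' Hb]]. apply in_seq in Hi'. apply andb_prop in Hb as [Hb1 Hb2].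
      apply Nat.eqb_eq in Hb1.
      rewrite (proj1 (NoDup_nth J 0%nat) Hnd i' i) in Hb2; auto; lia. }
  apply choice in Hpair as [g Hg].
  (* The codes below [2 ^ length J] are mapped by [g] injectively into the pairs of members of
     [ws]. *)
  rewrite <- (length_seq (2 ^ length J) 0), <- length_prod, <- (length_map g).
  apply NoDup_incl_length.
  - apply Injective_map_NoDup_in; [| apply seq_NoDup].
    intros a b Ha Hb Hab. apply in_seq in Ha. apply in_seq in Hb.
    apply (binary_code_inj (length J)); [lia | lia |]. intros i Hi.
    destruct (Hg a) as [x [y [Hw [Hw' [Hx [Hy Hcode]]]]]].
    destruct (Hg b) as [x' [y' [_ [_ [Hx' [Hy' Hcode']]]]]].
    rewrite Hab in Hx, Hy, Hw, Hw'.
    pose proof (Hsame _ _ _ i Hx Hx' (Hvalid _ Hw) Hi) as Dx.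
    pose proof (Hsame _ _ _ i Hy Hy' (Hvalid _ Hw') Hi) as Dy.
    specialize (Hcode i Hi). specialize (Hcode' i Hi). unfold dist_at in *.
    set (t := nth i J 0%nat) in *.
    pose proof (dist_triangle (Nat.iter t T x) (Nat.iter t T x') (Nat.iter t T y)).
    pose proof (dist_triangle (Nat.iter t T x') (Nat.iter t T y') (Nat.iter t T y)).
    pose proof (dist_triangle (Nat.iter t T x') (Nat.iter t T x) (Nat.iter t T y')).
    pose proof (dist_triangle (Nat.iter t T x) (Nat.iter t T y) (Nat.iter t T y')).
    rewrite (dist_sym (Nat.iter t T y') (Nat.iter t T y)) in *.
    rewrite (dist_sym (Nat.iter t T x') (Nat.iter t T x)) in *.
    destruct Hcode as [K1 K2], Hcode' as [K3 K4].
    destruct (Nat.testbit a i), (Nat.testbit b i); try reflexivity; exfalso;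
      [specialize (K1 eq_refl); specialize (K4 eq_refl)
      | specialize (K2 eq_refl); specialize (K3 eq_refl)]; lra.
  - intros ww Hww. apply in_map_iff in Hww as [a [<- _]].
    destruct (Hg a) as [x [y [Hw [Hw' _]]]].
    destruct (g a) as [w w']. apply in_prod; assumption.
Qed.

Lemma ln_bound_of_squares k n N :
  (0 < n)%nat -> (n <= 2 * k)%nat -> (2 ^ k <= N * N)%nat ->
  ln 2 / 4 <= ln (INR N) / INR n.
Proof.
  intros Hn Hk HN.
  assert (HN1 : (1 <= N)%nat).
  { destruct N; [| lia]. pose proof (Nat.pow_nonzero 2 k). lia. }
  apply le_INR in HN, HN1, Hk. rewrite mult_INR in HN, Hk. rewrite pow_INR in HN.
  simpl INR in HN, HN1, Hk.
  assert (Hln2 : 0 < ln 2) by (rewrite <- ln_1; apply ln_increasing; lra).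
  assert (Hpow : 0 < (1 + 1) ^ k) by (apply pow_lt; lra).
  assert (INR k * ln 2 <= 2 * ln (INR N)).
  { replace (2 * ln (INR N)) with (ln (INR N * INR N)) by (rewrite ln_mult; lra).
    replace (INR k * ln 2) with (ln ((1 + 1) ^ k)).
    - destruct HN as [HN | HN]; [left; apply ln_increasing; assumption | rewrite HN; right; reflexivity].
    - replace (1 + 1) with 2 by lra. apply ln_pow; lra. }
  apply lt_INR in Hn. simpl in Hn.
  apply (Rmult_le_reg_r (INR n)); [exact Hn |].
  unfold Rdiv at 2. rewrite Rmult_assoc, Rinv_l, Rmult_1_r by lra. nra.
Qed.

(** Arbitrarily large shattered families yield long late independent blocks. Along the sequence made
    of them, a cover by small balls has ln N / n at least ln 2 / 4 infinitely often. *)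
Lemma null_not_shattering e1 e2 :
  null_system d T -> e1 < e2 -> ~ forall m, exists x y, shatters e1 e2 m x y.
Proof.
  intros Hnull He Hsh.
  destruct (block_sequence (fun J => NoDup J /\ independent e1 e2 J)) as [A [HA Hblocks]].
  - intros B k. destruct (Hsh (2 ^ (S B + k))%nat) as [x [y Hxy]].
    destruct (independent_of_shatters e1 e2 _ x y He Hxy) as [l [Hnd [Hlen Hind]]].
    destruct (independent_late_block e1 e2 B k l Hnd Hlen Hind) as [J [H1 [H2 [H3 H4]]]].
    exists J. do 3 (split; [assumption |]). split; [| assumption].
    clear - H1. induction H1 as [| a J HJ IH Ha]; constructor; [| exact IH].
    rewrite Forall_forall in Ha. intro H. specialize (Ha a H). lia.
  - set (r := (e2 - e1) / 4).
    destruct (finite_ball_cover r) as [C HC]; [unfold r; lra |].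
    set (U := map (fun c x => d c x < r) C).
    assert (HU : finite_open_cover d U).
    { split.
      - intros V HV. apply in_map_iff in HV as [c [<- _]]. intros x Hx.
        exists (r - d c x). split; [lra |]. intros y Hy. pose proof (dist_triangle c x y). lra.
      - intro x. destruct (HC x) as [c [Hc Hx]]. exists (fun x => d c x < r).
        split; [apply in_map_iff; exists c; auto | exact Hx]. }
    pose proof (fun n => is_join_N_exists U A n HU) as HN. apply choice in HN as [N HN].
    assert (Hln2 : 0 < ln 2) by (rewrite <- ln_1; apply ln_increasing; lra).
    destruct (Hnull A HA U HU N HN (ln 2 / 8) ltac:(lra)) as [[M HM] _].
    destruct (Hblocks M) as [J [m [[Hnd Hind] [HMm [HmJ HJ]]]]].
    destruct (HN (m + length J)%nat) as [[ws [Hws Hlen]] _].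
    assert (Hsq : (2 ^ length J <= length ws * length ws)%nat).
    { apply (independent_subcover_bound e1 e2 r C A (m + length J) m J ws);
        auto; unfold r; lra. }
    rewrite Hlen in Hsq.
    assert (Hlow : ln 2 / 4 <= ln (INR (N (m + length J)%nat)) / INR (m + length J))
      by (apply (ln_bound_of_squares (length J)); [lia | lia | exact Hsq]).
    (* Index [n] of the entropy sequence refers to the first [S n] times. *)
    destruct (m + length J)%nat as [| n] eqn:En; [lia |].
    specialize (HM n ltac:(lia)). lra.
Qed.

End Separation.

(** * Limits along a minimal idempotent *)

Section UltrafilterLimits.

Context {X : Type} (d : X -> X -> R) (T : X -> X) (Hsys : dyn_system d T).
Context (p : (nat -> Prop) -> Prop) (Hp : minimal_idempotent p).

Let dsym := dist_sym d T Hsys.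
Let dtri := dist_triangle d T Hsys.

Definition ulim (u : nat -> X) (x : X) : Prop :=
  forall e, 0 < e -> p (fun n => d (u n) x < e).

(** If no point is a limit, the balls that do not contain [u n] for [p]-many n cover the space; some
    index avoids a finite subcover. The second conjunct of the cover empties all other balls. *)
Lemma ulim_exists u : exists x, ulim u x.
Proof.
  apply NNPP; intro Hno. pose proof (proj1 (proj2 Hsys)) as Hcomp.
  destruct (Hcomp (X * R)%type
    (fun xe y => d y (fst xe) < snd xe /\ ~ p (fun n => d (u n) (fst xe) < snd xe)))
    as [l Hl].
  - intros [x e] y [H1 H2]. simpl in *. exists (e - d y x). split; [lra |].
    intros z Hz. split; [| exact H2]. pose proof (dtri z y x). rewrite (dsym z y) in H. lra.
  - intro x. apply NNPP; intro H. apply Hno. exists x. intros e He.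
    apply NNPP; intro H'. apply H. exists (x, e). simpl.
    rewrite (dist_refl d T Hsys). auto.
  - assert (Hbad : p (fun n => forall xe, In xe l ->
      ~ (d (u n) (fst xe) < snd xe /\ ~ p (fun n => d (u n) (fst xe) < snd xe)))).
    { apply (large_list p Hp). intros xe _.
      destruct (classic (p (fun n => d (u n) (fst xe) < snd xe))) as [H | H].
      - apply (large_all p Hp). intros n [_ Hn]. auto.
      - apply (large_mono p Hp _ _ (large_not p Hp _ H)). intros n Hn [Hn' _]. auto. }
    destruct (large_witness p Hp _ 0 Hbad) as [n [_ Hn]].
    destruct (Hl (u n)) as [xe [Hin Hxe]]. exact (Hn xe Hin Hxe).
Qed.

Lemma ulim_iter u x i : ulim u x -> ulim (fun n => Nat.iter i T (u n)) (Nat.iter i T x).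
Proof.
  intro Hu. induction i as [| i IH]; [exact Hu |].
  intros e He. pose proof (proj2 (proj2 Hsys)) as Hcont.
  destruct (Hcont (Nat.iter i T x) e He) as [r [Hr HT]].
  apply (large_mono p Hp _ _ (IH r Hr)). intros n Hn. simpl.
  rewrite dsym. apply HT. rewrite dsym. exact Hn.
Qed.

Lemma ulim_dist_at u v x y i e :
  ulim u x -> ulim v y -> 0 < e ->
  p (fun n => Rabs (dist_at d T i (u n) (v n) - dist_at d T i x y) < e).
Proof.
  intros Hu Hv He.
  apply (large_mono p Hp _ _ (large_and p Hp _ _
    (ulim_iter u x i Hu (e / 2) ltac:(lra)) (ulim_iter v y i Hv (e / 2) ltac:(lra)))).
  unfold dist_at. intros n [H1 H2].
  set (a := Nat.iter i T (u n)) in *. set (b := Nat.iter i T (v n)) in *.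
  set (a' := Nat.iter i T x) in *. set (b' := Nat.iter i T y) in *.
  pose proof (dtri a a' b). pose proof (dtri a' b' b).
  pose proof (dtri a' a b'). pose proof (dtri a b b').
  rewrite (dsym a' a), (dsym b' b) in *. apply Rabs_def1; lra.
Qed.

Lemma inv_succ_small e : 0 < e -> p (fun n => / (INR n + 1) < e).
Proof.
  intro He. destruct (linear_eventually_above e 1 He) as [m Hm].
  apply (large_mono p Hp _ _ (idem_cofinite p Hp m)). intros n Hn.
  specialize (Hm n Hn). pose proof (pos_INR n).
  apply (Rmult_lt_reg_r (INR n + 1)); [lra |]. rewrite Rinv_l by lra. lra.
Qed.

Lemma ulim_of_close u v x :
  ulim u x -> (forall k, d (u k) (v k) < / (INR k + 1)) -> ulim v x.
Proof.
  intros Hu Huv e He.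
  apply (large_mono p Hp _ _ (large_and p Hp _ _ (Hu (e / 2) ltac:(lra))
    (inv_succ_small (e / 2) ltac:(lra)))).
  intros n [H1 H2]. pose proof (dtri (v n) (u n) x). specialize (Huv n).
  rewrite (dsym (v n) (u n)) in H. lra.
Qed.

Lemma close_pairs (Q : nat -> X -> X -> Prop) :
  (forall e k, 0 < e -> exists x y, d x y < e /\ Q k x y) ->
  exists x y z, ulim x z /\ ulim y z /\ forall k, Q k (x k) (y k).
Proof.
  intro H.
  assert (H' : forall k, exists xy, d (fst xy) (snd xy) < / (INR k + 1) /\ Q k (fst xy) (snd xy)).
  { intro k. destruct (H (/ (INR k + 1)) k) as [x [y Hxy]].
    - apply Rinv_0_lt_compat. pose proof (pos_INR k). lra.
    - exists (x, y). exact Hxy. }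
  apply choice in H' as [f Hf].
  destruct (ulim_exists (fun k => fst (f k))) as [z Hz].
  exists (fun k => fst (f k)), (fun k => snd (f k)), z. split; [exact Hz | split].
  - apply (ulim_of_close _ _ _ Hz). intro k. apply Hf.
  - intro k. apply Hf.
Qed.

Lemma iter_uniformly_continuous l e :
  0 < e -> exists r, 0 < r /\ forall x y, d x y < r -> forall i, (i <= l)%nat ->
    dist_at d T i x y < e.
Proof.
  intro He. apply NNPP; intro Hno.
  destruct (close_pairs (fun _ x y => exists i, (i <= l)%nat /\ e <= dist_at d T i x y))
    as [x [y [z [Hx [Hy HQ]]]]].
  - intros r _ Hr. apply NNPP; intro H. apply Hno. exists r. split; [exact Hr |].
    intros x y Hxy i Hi. apply Rnot_le_lt. intro Hle. apply H. exists x, y.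
    split; [exact Hxy | exists i; auto].
  - assert (Hsmall : p (fun n => forall i, (i < S l)%nat ->
      Rabs (dist_at d T i (x n) (y n) - dist_at d T i z z) < e)).
    { apply (large_below p Hp). intros i _. apply ulim_dist_at; assumption. }
    destruct (large_witness p Hp _ 0 Hsmall) as [n [_ Hn]].
    destruct (HQ n) as [i [Hi Hle]]. specialize (Hn i ltac:(lia)).
    replace (dist_at d T i z z) with 0 in Hn by (symmetry; apply (dist_refl d T Hsys)).
    apply Rabs_def2 in Hn. lra.
Qed.

Lemma dist_bounded : exists D, 0 < D /\ forall x y, d x y <= D.
Proof.
  apply NNPP; intro Hno.
  assert (H : forall k : nat, exists xy, INR k + 1 < d (fst xy) (snd xy)).
  { intro k. apply NNPP; intro H. apply Hno. exists (INR k + 1).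
    split; [pose proof (pos_INR k); lra |]. intros x y. apply Rnot_lt_le. intro Hlt.
    apply H. exists (x, y). exact Hlt. }
  apply choice in H as [f Hf].
  destruct (ulim_exists (fun k => fst (f k))) as [a Ha].
  destruct (ulim_exists (fun k => snd (f k))) as [b Hb].
  destruct (linear_eventually_above 1 (d a b) ltac:(lra)) as [m Hm].
  destruct (large_witness p Hp _ m (ulim_dist_at _ _ a b 0 1 Ha Hb ltac:(lra))) as [n [Hn H]].
  specialize (Hm n Hn). specialize (Hf n). apply Rabs_def2 in H. unfold dist_at in H.
  simpl in H. lra.
Qed.

Lemma dist_at_add i j x y :
  dist_at d T i (Nat.iter j T x) (Nat.iter j T y) = dist_at d T (i + j) x y.
Proof. unfold dist_at. rewrite !Nat.iter_add. reflexivity. Qed.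

Lemma proximal_sym x y : proximal d T x y -> proximal d T y x.
Proof.
  intros H e He. destruct (H e He) as [n [Hn Hd]]. exists n.
  rewrite dsym. auto.
Qed.

Lemma proximal_iter x y i :
  proximal d T x y -> proximal d T (Nat.iter i T x) (Nat.iter i T y).
Proof.
  intros H e He. destruct (iter_uniformly_continuous i e He) as [r [Hr Hi]].
  destruct (H r Hr) as [n [Hn Hd]]. exists n. split; [exact Hn |].
  rewrite <- !Nat.iter_add, (Nat.add_comm n i), !Nat.iter_add.
  exact (Hi _ _ Hd i (le_n i)).
Qed.

(* The action on points of the idempotent [p] of the enveloping semigroup. *)
Definition idem_point (x : X) : X :=
  epsilon (inhabits x) (ulim (fun n => Nat.iter n T x)).

Lemma idem_point_ulim x : ulim (fun n => Nat.iter n T x) (idem_point x).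
Proof. unfold idem_point. apply epsilon_spec, ulim_exists. Qed.

(** By idempotence, for [p]-many n the points T^(n+k) x are near [idem_point x] for [p]-many k,
    while along k they tend to T^n of [idem_point x]. *)
Lemma idem_point_idem x : ulim (fun n => Nat.iter n T (idem_point x)) (idem_point x).
Proof.
  intros e He.
  apply (large_mono p Hp _ _ (idem_prod p Hp _ (idem_point_ulim x (e / 2) ltac:(lra)))).
  intros n Hn.
  destruct (large_witness p Hp _ 0 (large_and p Hp _ _ Hn
    (ulim_iter _ _ n (idem_point_ulim x) (e / 2) ltac:(lra)))) as [k [_ [H1 H2]]].
  unfold shift in H1. rewrite Nat.iter_add in H1. simpl in H2.
  pose proof (dtri (Nat.iter n T (idem_point x)) (Nat.iter n T (Nat.iter k T x)) (idem_point x)).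
  rewrite (dsym (Nat.iter n T (idem_point x)) (Nat.iter n T (Nat.iter k T x))) in H. lra.
Qed.

(** Both orbits tend to [idem_point x] along [p]. *)
Lemma proximal_idem_point x : proximal d T x (idem_point x).
Proof.
  intros e He.
  destruct (large_witness p Hp _ 1 (large_and p Hp _ _ (idem_point_ulim x (e / 2) ltac:(lra))
    (idem_point_idem x (e / 2) ltac:(lra)))) as [n [Hn [H1 H2]]].
  exists n. split; [exact Hn |].
  pose proof (dtri (Nat.iter n T x) (idem_point x) (Nat.iter n T (idem_point x))).
  rewrite (dsym (idem_point x) (Nat.iter n T (idem_point x))) in H. lra.
Qed.

Lemma idem_point_recurrent (xs : list X) e :
  0 < e -> exists L, forall i, exists r, (i <= r <= i + L)%nat /\
    forall x, In x xs -> d (Nat.iter r T (idem_point x)) (idem_point x) < e.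
Proof.
  intro He.
  set (A := fun n => forall x, In x xs -> d (Nat.iter n T (idem_point x)) (idem_point x) < e / 2).
  assert (HA : p A).
  { apply (large_list p Hp). intros x _. apply idem_point_idem. lra. }
  destruct (idem_syndetic p Hp A HA) as [L HL]. exists L. intro i.
  assert (Hclose : p (fun n => forall x, In x xs -> forall j, (j < S L)%nat ->
    d (Nat.iter (i + j) T (Nat.iter n T (idem_point x))) (Nat.iter (i + j) T (idem_point x))
      < e / 2)).
  { apply (large_list p Hp). intros x _. apply (large_below p Hp). intros j _.
    apply (ulim_iter _ _ (i + j) (idem_point_idem x)). lra. }
  destruct (large_witness p Hp _ 0 (large_and p Hp _ _ (HL i) Hclose))
    as [n [_ [[j [Hj HAj]] Hn]]].
  exists (i + j)%nat. split; [lia |]. intros x Hx.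
  specialize (HAj x Hx). specialize (Hn x Hx j ltac:(lia)).
  replace (n + i + j)%nat with (i + j + n)%nat in HAj by lia. rewrite Nat.iter_add in HAj.
  pose proof (dtri (Nat.iter (i + j) T (idem_point x))
    (Nat.iter (i + j) T (Nat.iter n T (idem_point x))) (idem_point x)).
  rewrite (dsym (Nat.iter (i + j) T (idem_point x))
    (Nat.iter (i + j) T (Nat.iter n T (idem_point x)))) in H. lra.
Qed.

Lemma idem_point_orbit_recurrent (xs : list X) M e :
  0 < e -> exists L, forall i, exists r, (i <= r <= i + L)%nat /\
    forall x t, In x xs -> (t <= M)%nat ->
      d (Nat.iter (t + r) T (idem_point x)) (Nat.iter t T (idem_point x)) < e.
Proof.
  intro He. destruct (iter_uniformly_continuous M e He) as [r0 [Hr0 Hcont]].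
  destruct (idem_point_recurrent xs r0 Hr0) as [L HL]. exists L. intro i.
  destruct (HL i) as [r [Hr Hrec]]. exists r. split; [exact Hr |]. intros x t Hx Ht.
  rewrite Nat.iter_add. exact (Hcont _ _ (Hrec x Hx) t Ht).
Qed.

(* The patterns of m pairs occur syndetically, hence all of them occur in a long
   close window and in a long far window of a further pair. *)
Lemma windows_shatter (x y : nat -> X) c :
  (forall l, exists k t0 t1, forall i, (i <= l)%nat ->
     dist_at d T (t0 + i) (idem_point (x k)) (idem_point (y k)) <= c /\
     3 * c <= dist_at d T (t1 + i) (idem_point (x k)) (idem_point (y k))) ->
  forall m e, 0 < e -> exists (k : nat -> nat) L, forall i s, exists t, (i <= t <= i + L)%nat /\
    forall j, (j < m)%nat -> coded (c + e) (3 * c - e) (s j)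
      (dist_at d T t (idem_point (x (k j))) (idem_point (y (k j)))).
Proof.
  intros Hwin m. induction m as [| m IH]; intros e He.
  - exists (fun _ => 0%nat), 0%nat. intros i s. exists i. split; [lia | intros j Hj; lia].
  - destruct (IH (e / 2) ltac:(lra)) as [k [L HL]].
    (* Every window of length [L] shows all patterns of the first [m] pairs; the new pair has a
       close and a far window of that length. *)
    destruct (Hwin L) as [k0 [t0 [t1 Hk0]]].
    set (k' := fun j => if Nat.eqb j m then k0 else k j).
    set (M := (t0 + t1 + L)%nat).
    (* Recurrence copies a pattern found before time [M] to all parts of the time axis. An error of
       e/4 per point adds e/2 to the e/2 already spent. *)
    destruct (idem_point_orbit_recurrent
      (map x (map k' (seq 0 (S m))) ++ map y (map k' (seq 0 (S m)))) M (e / 4) ltac:(lra))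
      as [L' HL'].
    exists k', (L' + M)%nat. intros i s.
    destruct (HL' i) as [r [Hr Hrec]].
    destruct (HL (if s m then t1 else t0) s) as [t [Ht Hcode]].
    assert (HtM : (t <= M)%nat) by (unfold M; destruct (s m); lia).
    exists (t + r)%nat. split; [lia |]. intros j Hj.
    assert (Hin : In (k' j) (map k' (seq 0 (S m)))) by (apply in_map, in_seq; lia).
    pose proof (Hrec (x (k' j)) t ltac:(apply in_or_app; left; apply in_map, Hin) HtM) as Hx.
    pose proof (Hrec (y (k' j)) t ltac:(apply in_or_app; right; apply in_map, Hin) HtM) as Hy.
    assert (Hold : coded (c + e / 2) (3 * c - e / 2) (s j)
      (dist_at d T t (idem_point (x (k' j))) (idem_point (y (k' j))))).
    { unfold k'. destruct (Nat.eqb_spec j m) as [-> | Hne]; [| apply Hcode; lia].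
      split; intro Hs; rewrite Hs in Ht.
      - destruct (Hk0 (t - t1)%nat ltac:(lia)) as [_ H].
        replace (t1 + (t - t1))%nat with t in H by lia. lra.
      - destruct (Hk0 (t - t0)%nat ltac:(lia)) as [H _].
        replace (t0 + (t - t0))%nat with t in H by lia. lra. }
    unfold dist_at in *.
    set (a := Nat.iter t T (idem_point (x (k' j)))) in *.
    set (b := Nat.iter t T (idem_point (y (k' j)))) in *.
    set (a' := Nat.iter (t + r) T (idem_point (x (k' j)))) in *.
    set (b' := Nat.iter (t + r) T (idem_point (y (k' j)))) in *.
    pose proof (dtri a a' b). pose proof (dtri a' b' b).
    pose proof (dtri a' a b'). pose proof (dtri a b b').
    rewrite (dsym a a'), (dsym b b') in *.
    destruct Hold as [H3 H4]. split; intro Hs; [specialize (H3 Hs) | specialize (H4 Hs)]; lra.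
Qed.

(** * Consequences of a closed proximal relation *)

Section ClosedProximal.

Context (Hclosed : closed_rel d (proximal d T)).

Lemma proximal_ulim u v x y :
  ulim u x -> ulim v y -> (forall k, proximal d T (u k) (v k)) -> proximal d T x y.
Proof.
  intros Hu Hv HP. apply NNPP; intro Hno.
  destruct (Hclosed x y Hno) as [r [Hr Hball]].
  destruct (large_witness p Hp _ 0 (large_and p Hp _ _ (Hu r Hr) (Hv r Hr))) as [n [_ [H1 H2]]].
  rewrite dsym in H1, H2. exact (Hball _ _ H1 H2 (HP n)).
Qed.

(** Compactness: proximal pairs with ever longer waiting times would have a limit pair that is
    proximal, by closedness, yet never closer than [e] at positive times. *)
Lemma proximal_uniform e :
  0 < e -> exists L, forall x y, proximal d T x y ->
    exists n, (1 <= n <= L)%nat /\ dist_at d T n x y < e.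
Proof.
  intro He. apply NNPP; intro Hno.
  assert (H : forall L, exists xy, proximal d T (fst xy) (snd xy) /\
    forall n, (1 <= n <= L)%nat -> e <= dist_at d T n (fst xy) (snd xy)).
  { intro L. apply NNPP; intro H. apply Hno. exists L. intros x y Hxy.
    apply NNPP; intro H'. apply H. exists (x, y). split; [exact Hxy |].
    intros n Hn. apply Rnot_lt_le. intro Hlt. apply H'. exists n; auto. }
  apply choice in H as [f Hf].
  destruct (ulim_exists (fun k => fst (f k))) as [a Ha].
  destruct (ulim_exists (fun k => snd (f k))) as [b Hb].
  assert (HP : proximal d T a b)
    by (apply (proximal_ulim _ _ _ _ Ha Hb); intro k; apply Hf).
  destruct (HP (e / 2) ltac:(lra)) as [n [Hn Hd]].
  destruct (large_witness p Hp _ n (ulim_dist_at _ _ a b n (e / 2) Ha Hb ltac:(lra)))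
    as [k [Hk H]].
  pose proof (proj2 (Hf k) n ltac:(lia)). apply Rabs_def2 in H. unfold dist_at in *. lra.
Qed.

(** The orbit of the pair stays proximal, so the uniform waiting time applies from every start;
    uniform continuity prolongs one very close time to an interval. *)
Lemma proximal_thickly_syndetic x y e :
  proximal d T x y -> 0 < e -> thickly_syndetic (fun n => dist_at d T n x y < e).
Proof.
  intros Hxy He l. destruct (iter_uniformly_continuous l e He) as [r [Hr Hcont]].
  destruct (proximal_uniform r Hr) as [L HL]. exists (L + l)%nat. intro a.
  destruct (HL _ _ (proximal_iter x y a Hxy)) as [n [Hn Hd]].
  exists (n + a)%nat. split; [lia | split; [lia |]]. intros i Hi.
  rewrite dist_at_add in Hd.
  rewrite (Nat.add_comm (n + a) i), <- dist_at_add. apply Hcont; [exact Hd | exact Hi].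
Qed.

(** During a window of length [L] in which [x] and [y] stay close, [y] and [z] must come close
    once. *)
Lemma proximal_trans x y z : proximal d T x y -> proximal d T y z -> proximal d T x z.
Proof.
  intros Hxy Hyz e He.
  destruct (proximal_uniform (e / 2) ltac:(lra)) as [L HL].
  destruct (proximal_thickly_syndetic x y (e / 2) Hxy ltac:(lra) L) as [L' HL'].
  destruct (HL' 0%nat) as [a [_ [_ Hnear]]].
  destruct (HL _ _ (proximal_iter y z a Hyz)) as [n [Hn Hd]].
  exists (a + n)%nat. split; [lia |]. specialize (Hnear n ltac:(lia)).
  rewrite dist_at_add, Nat.add_comm in Hd. unfold dist_at in *.
  pose proof (dtri (Nat.iter (a + n) T x) (Nat.iter (a + n) T y) (Nat.iter (a + n) T z)). lra.
Qed.

(* The quotient by the proximal relation is equicontinuous. *)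
Lemma limit_pair_proximal x y z (n : nat -> nat) a b :
  null_system d T -> ulim x z -> ulim y z ->
  ulim (fun k => Nat.iter (n k) T (x k)) a -> ulim (fun k => Nat.iter (n k) T (y k)) b ->
  proximal d T a b.
Proof.
  intros Hnull Hx Hy Ha Hb. apply NNPP; intro Hab.
  (* Passing to idempotent images changes all limits only within their proximal classes, and makes
     the pairs recurrent. *)
  destruct (ulim_exists (fun k => idem_point (x k))) as [x' Hx'].
  destruct (ulim_exists (fun k => idem_point (y k))) as [y' Hy'].
  destruct (ulim_exists (fun k => Nat.iter (n k) T (idem_point (x k)))) as [a' Ha'].
  destruct (ulim_exists (fun k => Nat.iter (n k) T (idem_point (y k)))) as [b' Hb'].
  assert (Hxy' : proximal d T x' y').
  { apply (proximal_trans _ z).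
    - apply proximal_sym, (proximal_ulim _ _ _ _ Hx Hx'). intro k. apply proximal_idem_point.
    - apply (proximal_ulim _ _ _ _ Hy Hy'). intro k. apply proximal_idem_point. }
  assert (Hab' : ~ proximal d T a' b').
  { intro H. apply Hab. apply (proximal_trans _ a'); [| apply (proximal_trans _ b'); [exact H |]].
    - apply (proximal_ulim _ _ _ _ Ha Ha'). intro k. apply proximal_iter, proximal_idem_point.
    - apply proximal_sym, (proximal_ulim _ _ _ _ Hb Hb'). intro k.
      apply proximal_iter, proximal_idem_point. }
  apply not_all_ex_not in Hab' as [c Hc]. apply imply_to_and in Hc as [Hc Hfar].
  assert (Hfar' : forall i, c <= dist_at d T (1 + i) a' b').
  { intro i. apply Rnot_lt_le. intro H. apply Hfar. exists (1 + i)%nat. split; [lia | exact H]. }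
  apply (null_not_shattering d T Hsys (c / 4) (c / 2) Hnull ltac:(lra)).
  intro m.
  (* The thresholds become c/5 + c/20 = c/4 and 3c/5 - c/20 = 11c/20 > c/2. *)
  destruct (windows_shatter x y (c / 5)) with (m := m) (e := c / 20) as [k [L HL]]; [| lra |].
  - intro l. destruct (iter_uniformly_continuous l (c / 10) ltac:(lra)) as [r [Hr Hcont]].
    destruct (Hxy' r Hr) as [t0 [_ Ht0]].
    assert (Hlarge : p (fun k => forall i, (i < S l)%nat ->
      Rabs (dist_at d T (t0 + i) (idem_point (x k)) (idem_point (y k))
            - dist_at d T (t0 + i) x' y') < c / 10 /\
      Rabs (dist_at d T (1 + i) (Nat.iter (n k) T (idem_point (x k)))
              (Nat.iter (n k) T (idem_point (y k)))
            - dist_at d T (1 + i) a' b') < c / 10)).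
    { apply (large_below p Hp). intros i _. apply (large_and p Hp).
      - apply (ulim_dist_at (fun k => idem_point (x k)) (fun k => idem_point (y k))
          x' y'); [exact Hx' | exact Hy' | lra].
      - apply (ulim_dist_at (fun k => Nat.iter (n k) T (idem_point (x k)))
          (fun k => Nat.iter (n k) T (idem_point (y k)))); [exact Ha' | exact Hb' | lra]. }
    destruct (large_witness p Hp _ 0 Hlarge) as [k [_ Hk]].
    (* The close window starts where [x'] and [y'] meet; the far one starts one step after [n k], as
       non-proximality only bounds distances at positive times. *)
    exists k, t0, (1 + n k)%nat. intros i Hi. destruct (Hk i ltac:(lia)) as [H1 H2].
    specialize (Hcont _ _ Ht0 i Hi). specialize (Hfar' i).
    rewrite dist_at_add, Nat.add_comm in Hcont. rewrite dist_at_add in H2.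
    replace (1 + i + n k)%nat with (1 + n k + i)%nat in H2 by lia.
    apply Rabs_def2 in H1, H2. lra.
  - exists (fun j => idem_point (x (k j))), (fun j => idem_point (y (k j))).
    intro s. destruct (HL 0%nat s) as [t [_ Ht]]. exists t. intros j Hj.
    destruct (Ht j Hj) as [H1 H2]. split; intro Hs; [specialize (H1 Hs) | specialize (H2 Hs)]; lra.
Qed.

End ClosedProximal.

End UltrafilterLimits.

(** * Mean equicontinuity *)

Fixpoint psum (f : nat -> R) (n : nat) : R :=
  match n with O => 0 | S k => psum f k + f k end.

Lemma psum_le (f g : nat -> R) n :
  (forall i, (i < n)%nat -> f i <= g i) -> psum f n <= psum g n.
Proof.
  induction n as [| n IH]; intro H; simpl; [lra |].
  pose proof (H n ltac:(lia)). pose proof (IH ltac:(intros; apply H; lia)). lra.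
Qed.

Lemma psum_plus (f g : nat -> R) n : psum (fun i => f i + g i) n = psum f n + psum g n.
Proof. induction n as [| n IH]; simpl; [| rewrite IH]; lra. Qed.

Lemma psum_const c n : psum (fun _ => c) n = c * INR n.
Proof. induction n as [| n IH]; [simpl; lra |]. rewrite S_INR. simpl. rewrite IH. lra. Qed.

Lemma psum_add (f : nat -> R) j k : psum f (j + k) = psum f j + psum (fun i => f (j + i)%nat) k.
Proof.
  induction k as [| k IH]; simpl.
  - rewrite Nat.add_0_r. lra.
  - rewrite Nat.add_succ_r. simpl. rewrite IH. lra.
Qed.

Lemma psum_ext (f g : nat -> R) n : (forall i, f i = g i) -> psum f n = psum g n.
Proof. intro H. apply Rle_antisym; apply psum_le; intros; rewrite H; lra. Qed.

Lemma sum_f_R0_psum (f : nat -> R) n : sum_f_R0 f n = psum f (S n).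
Proof. induction n as [| n IH]; simpl; [lra |]. rewrite IH. simpl. lra. Qed.

(* Otherwise the integers could be cut into blocks of length at most [M] on
   which the averages are below [c]. *)
Lemma large_initial_averages (a : nat -> R) D c M :
  0 < c -> 0 <= D -> (forall i, 0 <= a i <= D) ->
  (forall N, exists n, (N <= n)%nat /\ 2 * c * INR n <= psum a n) ->
  exists n, forall j, (j <= M)%nat -> c * INR j <= psum (fun i => a (n + i)%nat) j.
Proof.
  intros Hc HD Ha Hfreq. apply NNPP; intro Hno.
  assert (Hblock : forall n, exists j, (j <= M)%nat /\
    psum (fun i => a (n + i)%nat) j < c * INR j).
  { intro n. apply NNPP; intro H. apply Hno. exists n. intros j Hj.
    apply Rnot_lt_le. intro Hlt. apply H. exists j; auto. }
  (* Blocks with average below [c] are cut off one at a time; the last piece, of length at most [M],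
     costs at most [D * INR M]. *)
  assert (Hsum : forall n s, psum (fun i => a (s + i)%nat) n <= c * INR n + D * INR M).
  { intro n. induction n as [n IH] using (well_founded_induction Wf_nat.lt_wf). intro s.
    destruct (Nat.le_gt_cases n M) as [Hn | Hn].
    - apply Rle_trans with (psum (fun _ => D) n); [apply psum_le; intros; apply Ha |].
      rewrite psum_const. apply le_INR in Hn. pose proof (pos_INR n). nra.
    - destruct (Hblock s) as [[| j] [Hj Hlt]]; [simpl in Hlt; lra |].
      replace n with (S j + (n - S j))%nat at 1 by lia. rewrite psum_add.
      specialize (IH (n - S j)%nat ltac:(lia) (s + S j)%nat).
      rewrite minus_INR in IH by lia.
      rewrite (psum_ext _ (fun i => a (s + S j + i)%nat) (n - S j));
        [lra | intro i; f_equal; lia]. }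
  destruct (linear_eventually_above c (D * INR M + 1) Hc) as [N HN].
  destruct (Hfreq N) as [n [Hn Hlow]]. specialize (HN n Hn). specialize (Hsum n 0%nat).
  simpl in Hsum. change (fun i => a i) with a in Hsum. lra.
Qed.

(** The limsup is the infimum of the eventual upper bounds, obtained as a supremum of their
    negatives. *)
Lemma limsup_exists (a : nat -> R) c :
  (forall n, 0 <= a n) -> (exists M, forall n, (M <= n)%nat -> a n <= c) ->
  exists l, is_limsup a l /\ l <= c.
Proof.
  intros Hpos [M0 HM0].
  destruct (completeness (fun r => exists M, forall n, (M <= n)%nat -> a n <= - r))
    as [l [Hub Hlub]].
  - exists 0. intros r [M HM]. specialize (HM M (le_n M)). specialize (Hpos M). lra.
  - exists (- c), M0. intros n Hn. specialize (HM0 n Hn). lra.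
  - exists (- l). split.
    + intros eps Heps. split.
      * apply NNPP; intro Hno.
        assert (l <= l - eps); [| lra]. apply Hlub. intros r [M HM].
        apply Rnot_lt_le. intro Hr. apply Hno. exists M. intros n Hn. specialize (HM n Hn). lra.
      * intro M. apply NNPP; intro Hno.
        assert (l + eps <= l); [| lra]. apply Hub. exists M. intros n Hn.
        apply Rnot_lt_le. intro Hlt. apply Hno. exists n. split; [exact Hn | lra].
    + assert (- c <= l); [| lra]. apply Hub. exists M0. intros n Hn.
      specialize (HM0 n Hn). lra.
Qed.

Section MeanEquicontinuity.

Context {X : Type} (d : X -> X -> R) (T : X -> X) (Hsys : dyn_system d T).

Let dsym := dist_sym d T Hsys.
Let dtri := dist_triangle d T Hsys.

Lemma mean_dist_psum x y n :
  mean_dist d T x y n = psum (fun i => dist_at d T i x y) (S n) / INR (S n).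
Proof. unfold mean_dist. rewrite sum_f_R0_psum. reflexivity. Qed.

Lemma proximal_reg_proximal x y : proximal d T x y -> reg_proximal d T x y.
Proof.
  intros H e He. destruct (H e He) as [n [Hn Hd]]. exists x, y, n.
  rewrite !(dist_refl d T Hsys). auto.
Qed.

Lemma reg_proximal_closed : closed_rel d (reg_proximal d T).
Proof.
  intros x y Hno. apply not_all_ex_not in Hno as [e Hno]. apply imply_to_and in Hno as [He Hno].
  exists (e / 2). split; [lra |]. intros x' y' Hx Hy HQ. apply Hno.
  destruct (HQ (e / 2) ltac:(lra)) as [x2 [y2 [n [H1 [H2 [H3 H4]]]]]].
  exists x2, y2, n. pose proof (dtri x x' x2). pose proof (dtri y y' y2).
  repeat split; try lra; lia.
Qed.

Lemma mean_equicontinuous_averages e :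
  mean_equicontinuous d T -> 0 < e -> exists r, 0 < r /\ forall x y, d x y < r ->
    exists M, forall n, (M <= n)%nat -> psum (fun i => dist_at d T i x y) n <= e * INR n.
Proof.
  intros H He. destruct (H e He) as [r [Hr Hlim]]. exists r. split; [exact Hr |].
  intros x y Hxy. destruct (Hlim x y Hxy) as [l [Hl Hle]].
  (* [mean_dist] at index [n] averages [S n] terms, hence [S M]. *)
  destruct (Hl (e - l) ltac:(lra)) as [[M HM] _]. exists (S M). intros [| n] Hn; [lia |].
  specialize (HM n ltac:(lia)). rewrite mean_dist_psum in HM.
  replace (l + (e - l)) with e in HM by lra.
  assert (0 < INR (S n)) by (apply lt_0_INR; lia).
  apply (Rmult_lt_compat_r (INR (S n))) in HM; [| assumption].
  unfold Rdiv in HM. rewrite Rmult_assoc, Rinv_l, Rmult_1_r in HM by lra. lra.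
Qed.

(** The triangle inequality through x', y' bounds the average for (x, y) by three small averages,
    the third starting at time k when x' and y' are close. A pair that is not proximal has averages
    bounded below. *)
Lemma mean_equicontinuous_reg_proximal x y :
  mean_equicontinuous d T -> reg_proximal d T x y -> proximal d T x y.
Proof.
  intros Hmean HQ e He.
  destruct (mean_equicontinuous_averages (e / 8) Hmean ltac:(lra)) as [r [Hr Havg]].
  destruct (HQ r Hr) as [x' [y' [k [Hx [Hy [_ Hxy']]]]]].
  destruct (Havg _ _ Hx) as [M1 HM1]. destruct (Havg _ _ Hy) as [M2 HM2].
  destruct (Havg _ _ Hxy') as [M3 HM3].
  set (f := fun i => dist_at d T i x y). set (f' := fun i => dist_at d T i x' y').
  apply NNPP; intro Hno.
  assert (Hlow : forall n, e * (INR n - 1) <= psum f n).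
  { induction n as [| n IH]; [simpl; lra |]. rewrite S_INR. simpl.
    destruct n as [| n].
    - pose proof (dist_pos d T Hsys (Nat.iter 0 T x) (Nat.iter 0 T y)). unfold f, dist_at.
      simpl in *. lra.
    - assert (e <= f (S n)); [| lra]. apply Rnot_lt_le. intro Hlt. apply Hno.
      exists (S n). split; [lia | exact Hlt]. }
  (* Beyond [M] the first k terms and the lost term at time 0 cost at most e/2 on average; with
     three times e/8 this stays below e. *)
  destruct (linear_eventually_above (e / 2) (psum f' k + e + 1) ltac:(lra)) as [M HM].
  set (n := (k + (M1 + M2 + M3 + M))%nat).
  specialize (HM1 n ltac:(unfold n; lia)). specialize (HM2 n ltac:(unfold n; lia)).
  specialize (HM3 (M1 + M2 + M3 + M)%nat ltac:(lia)). specialize (HM n ltac:(unfold n; lia)).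
  assert (Hf' : psum f' n <= psum f' k + e / 8 * INR n).
  { unfold n at 1. rewrite psum_add. apply Rplus_le_compat_l.
    rewrite (psum_ext _ (fun i => dist_at d T i (Nat.iter k T x') (Nat.iter k T y'))).
    - apply Rle_trans with (1 := HM3). apply Rmult_le_compat_l; [lra |].
      apply le_INR. unfold n; lia.
    - intro i. unfold f', dist_at. rewrite Nat.add_comm, !Nat.iter_add. reflexivity. }
  assert (Hup : psum f n <= psum (fun i => dist_at d T i x x') n +
    (psum f' n + psum (fun i => dist_at d T i y y') n)).
  { rewrite <- !psum_plus. apply psum_le. intros i _. unfold f, f', dist_at.
    pose proof (dtri (Nat.iter i T x) (Nat.iter i T x') (Nat.iter i T y)).
    pose proof (dtri (Nat.iter i T x') (Nat.iter i T y') (Nat.iter i T y)).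
    rewrite (dsym (Nat.iter i T y') (Nat.iter i T y)) in *. lra. }
  specialize (Hlow n). pose proof (pos_INR n). nra.
Qed.

Section ClosedProximal.

Context (p : (nat -> Prop) -> Prop) (Hp : minimal_idempotent p).
Context (Hclosed : closed_rel d (proximal d T)) (Hnull : null_system d T).

(** Otherwise the far times have positive density and the close times are thickly syndetic, so pairs
    along the single orbit of (u, v) are shattered in any number. *)
Lemma proximal_small_averages u v c :
  proximal d T u v -> 0 < c ->
  ~ forall j, c * INR j <= psum (fun i => dist_at d T i u v) j.
Proof.
  intros Huv Hc Havg.
  destruct (dist_bounded d T Hsys p Hp) as [D [HD Hbound]].
  set (F := fun i => c / 2 <= dist_at d T i u v).
  set (N := fun i => dist_at d T i u v < c / 4).
  assert (HF : pos_density p F).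
  { exists (c / (2 * D)). split; [apply Rdiv_lt_0_compat; lra |].
    apply (large_all p Hp). intro n.
    assert (Hle : psum (fun i => dist_at d T i u v) n <= D * count F n + c / 2 * INR n).
    { clear - HD Hbound Hc. induction n as [| n IH]; [simpl; lra |].
      rewrite S_INR. simpl.
      destruct (classic (F n)) as [H | H].
      - rewrite indicator_true by exact H.
        pose proof (Hbound (Nat.iter n T u) (Nat.iter n T v)). unfold dist_at in *. lra.
      - rewrite indicator_false by exact H. unfold F in H. lra. }
    specialize (Havg n).
    apply (Rmult_le_reg_l D); [exact HD |].
    replace (D * (c / (2 * D) * INR n)) with (c / 2 * INR n) by (field; lra). lra. }
  assert (HN : thickly_syndetic N)
    by (apply (proximal_thickly_syndetic d T Hsys p Hp Hclosed); [exact Huv | lra]).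
  apply (null_not_shattering d T Hsys (c / 4) (c / 2) Hnull ltac:(lra)).
  intro m. destruct (density_independence p Hp F N m HF HN) as [n [t Hnt]].
  exists (fun j => Nat.iter (t j) T u), (fun j => Nat.iter (t j) T v).
  intro s. exists (n s). intros j Hj. destruct (Hnt s j Hj) as [H1 H2].
  rewrite dist_at_add, Nat.add_comm.
  split; intro Hs; [exact (H1 Hs) | left; exact (H2 Hs)].
Qed.

(** Failure gives ever closer pairs whose averages from time [n k] on are large for all lengths up
    to k. The limit of the pairs moved to these times is proximal and has large averages for all
    lengths. *)
Lemma closed_proximal_mean_equicontinuous : mean_equicontinuous d T.
Proof.
  intros e He. apply NNPP; intro Hno.
  destruct (dist_bounded d T Hsys p Hp) as [D [HD Hbound]].
  destruct (close_pairs d T Hsys p Hp (fun k x y => exists n, forall j, (j <= k)%nat ->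
    e / 4 * INR j <= psum (fun i => dist_at d T (n + i) x y) j)) as [x [y [z [Hx [Hy HQ]]]]].
  - intros r M Hr. apply NNPP; intro Hnone. apply Hno. exists r. split; [exact Hr |].
    intros x y Hxy.
    (* Averages above e/2 infinitely often become e/4 on all initial lengths, and e/8 in the
       limit. *)
    destruct (limsup_exists (mean_dist d T x y) (e / 2)) as [l [Hl Hle]].
    + intro n. rewrite mean_dist_psum.
      assert (0 <= psum (fun i => dist_at d T i x y) (S n)).
      { apply Rle_trans with (psum (fun _ => 0) (S n)); [rewrite psum_const; lra |].
        apply psum_le. intros i _. apply (dist_pos d T Hsys). }
      apply Rmult_le_pos; [assumption |]. left. apply Rinv_0_lt_compat, lt_0_INR. lia.
    + apply NNPP; intro Hfreq. apply Hnone. exists x, y. split; [exact Hxy |].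
      apply (large_initial_averages (fun i => dist_at d T i x y) D (e / 4) M); [lra | lra | |].
      * intro i. split; [apply (dist_pos d T Hsys) | apply Hbound].
      * intro N. apply NNPP; intro H. apply Hfreq. exists N. intros n Hn.
        rewrite mean_dist_psum. apply Rnot_lt_le. intro Hlt. apply H.
        exists (S n). split; [lia |].
        assert (0 < INR (S n)) by (apply lt_0_INR; lia).
        apply (Rmult_lt_compat_r (INR (S n))) in Hlt; [| assumption].
        unfold Rdiv at 2 in Hlt. rewrite Rmult_assoc, Rinv_l, Rmult_1_r in Hlt by lra. lra.
    + exists l. split; [exact Hl | lra].
  - apply choice in HQ as [n Hn].
    destruct (ulim_exists d T Hsys p Hp (fun k => Nat.iter (n k) T (x k))) as [u Hu].
    destruct (ulim_exists d T Hsys p Hp (fun k => Nat.iter (n k) T (y k))) as [v Hv].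
    pose proof (limit_pair_proximal d T Hsys p Hp Hclosed x y z n u v Hnull Hx Hy Hu Hv) as Huv.
    apply (proximal_small_averages u v (e / 8) Huv ltac:(lra)). intro j.
    assert (Hclose : p (fun k => forall i, (i < j)%nat ->
      Rabs (dist_at d T i (Nat.iter (n k) T (x k)) (Nat.iter (n k) T (y k))
        - dist_at d T i u v) < e / 8)).
    { apply (large_below p Hp). intros i _.
      apply (ulim_dist_at d T Hsys p Hp (fun k => Nat.iter (n k) T (x k))
        (fun k => Nat.iter (n k) T (y k))); [exact Hu | exact Hv | lra]. }
    destruct (large_witness p Hp _ j Hclose) as [k [Hk Hclose_k]].
    specialize (Hn k j Hk).
    assert (psum (fun i => dist_at d T (n k + i) (x k) (y k)) j
      <= psum (fun i => dist_at d T i u v + e / 8) j).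
    { apply psum_le. intros i Hi. specialize (Hclose_k i Hi).
      rewrite dist_at_add, Nat.add_comm in Hclose_k. apply Rabs_def2 in Hclose_k. lra. }
    rewrite psum_plus, psum_const in H. lra.
Qed.

End ClosedProximal.

End MeanEquicontinuity.

Theorem mainTheorem7 (X : Type) (d : X -> X -> R) (T : X -> X)
  (Hsys : dyn_system d T) (Hnull : null_system d T) :
  (closed_rel d (proximal d T) <->
     (forall x y, proximal d T x y <-> reg_proximal d T x y)) /\
  ((forall x y, proximal d T x y <-> reg_proximal d T x y) <->
     mean_equicontinuous d T).
Proof.
  (* The cycle runs from closedness to mean equicontinuity, to the equality of the two relations,
     and back to closedness. *)
  assert (H13 : closed_rel d (proximal d T) -> mean_equicontinuous d T).
  { intro Hclosed. destruct minimal_idempotent_exists as [p Hp].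
    exact (closed_proximal_mean_equicontinuous d T Hsys p Hp Hclosed Hnull). }
  assert (H32 : mean_equicontinuous d T ->
    forall x y, proximal d T x y <-> reg_proximal d T x y).
  { intros Hmean x y. split; [apply (proximal_reg_proximal d T Hsys) |].
    apply (mean_equicontinuous_reg_proximal d T Hsys); exact Hmean. }
  assert (H21 : (forall x y, proximal d T x y <-> reg_proximal d T x y) ->
    closed_rel d (proximal d T)).
  { intros Heq x y Hno. destruct (reg_proximal_closed d T Hsys x y) as [r [Hr Hball]].
    - rewrite <- Heq. exact Hno.
    - exists r. split; [exact Hr |]. intros x' y' Hx Hy. rewrite Heq. auto. }
  tauto.
Qed.
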